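(* Let $(E,d)$ be a Polish space with a closed partial order $\le$, and let $\varphi$ be an order-preserving, strongly mixing random dynamical system on $E$ over a metric dynamical system $(\Omega,\mathcal F,\mathbb P,(\theta_t)_{t\in\mathbb R})$, with limit distribution $\mu$ (a Borel probability measure on $E$). Assume that for every $\varepsilon>0$ there exist $f,g\in E$ with $f\le g$ such that $$\mu([f,g])\ge 1-\varepsilon .$$ Then weak synchronization holds, i.e. there is an $\mathcal F_0$-measurable, $\varphi$-invariant random variable $a:\Omega\to E$ such that for every $x\in E$ $$d\big(\varphi_t(\theta_{-t}\omega,x),a(\omega)\big)\to 0\quad\text{for } t\to\infty,\ \text{in probability}.$$
   Context: A Polish space $(E,d)$: the topology induced by the metric $d$ is that of a space homeomorphic to a complete separable metric space; $E$ carries its Borel $\sigma$-algebra. A partial order $\le$ on $E$ is closed if $\{(x,y)\in E\times E: x\le y\}$ is closed in $E\times E$. For $f\le g$, $[f,g]:=\{x\in E: f\le x\le g\}$. Metric dynamical system: $(\Omega,\mathcal F,\mathbb P)$ is a probability space (not necessarily complete) and $(\theta_t)_{t\in\mathbb R}$ is a group of jointly measurable maps on $\Omega$ leaving $\mathbb P$ invariant. A random dynamical system (RDS) on $E$ is a measurable map $\varphi:\mathbb R_+\times\Omega\times E\to E$ with $\varphi_0(\omega,x)=x$ and $\varphi_{t+s}(\omega,x)=\varphi_t(\theta_s\omega,\varphi_s(\omega,x))$ for all $x\in E$, $t,s\ge 0$, $\omega\in\Omega$, and such that $x\mapsto\varphi_s(\omega,x)$ is continuous for all $s\ge0$, $\omega\in\Omega$.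 No independence of increments (white noise property) is assumed. Order-preserving: $x\le y$ implies $\varphi_t(\omega,x)\le\varphi_t(\omega,y)$ for all $t\ge0$, $\omega\in\Omega$. Strongly mixing with limit distribution $\mu$: for every $x\in E$ the laws of $\varphi_t(\cdot,x)$ converge weakly (tested against bounded continuous functions) to the probability measure $\mu$ as $t\to\infty$. Filtration: for $s\le t$, $\mathcal F_{s,t}$ is the $\sigma$-algebra generated by the maps $\omega\mapsto\varphi_h(\theta_s\omega,x)$, $h\in[0,t-s]$, $x\in E$; $\mathcal F_0$ is the smallest $\sigma$-algebra containing all $\mathcal F_{s,0}$, $s\le0$. A random variable $a:\Omega\to E$ is $\varphi$-invariant if for each $t\ge0$, $\varphi_t(\omega,a(\omega))=a(\theta_t\omega)$ for $\mathbb P$-almost all $\omega$ (the null set may depend on $t$). Weak synchronization means that there is a weak point attractor consisting of a single random point, i.e. a $\varphi$-invariant random compact set $A(\omega)=\{a(\omega)\}$ with the convergence in probability stated in the claim for every single point $x$. *)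

(* Defs.v *)
From HB Require Import structures.
From mathcomp Require Import all_boot all_order all_algebra.
From mathcomp Require Import all_classical all_reals all_analysis.
Set Implicit Arguments.
Unset Strict Implicit.
Unset Printing Implicit Defensive.
Import Order.TTheory GRing.Theory Num.Theory.
Import numFieldNormedType.Exports.
Local Open Scope classical_set_scope.
Local Open Scope ring_scope.

(* MathComp-Analysis requires measurable types to be pointed, hence the
   Pointed component. *)
#[short(type="pmetricType")]
HB.structure Definition PointedMetric (R : numDomainType) :=
  {T of Metric R T & Pointed T}.

#[short(type="porderPMetricType")]
HB.structure Definition POrderedPointedMetric d (R : numDomainType) :=
  {T of Metric R T & Pointed T & Order.POrder d T}.

#[short(type="completeMetricType")]
HB.structure Definition CompleteMetric (R : numDomainType) :=
  {T of Complete T & Metric R T & Pointed T}.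

Definition separable (T : topologicalType) : Prop :=
  exists2 D : set T, countable D & dense D.

Definition homeomorphic (T U : topologicalType) : Prop :=
  exists (f : T -> U) (g : U -> T),
    [/\ cancel f g, cancel g f, continuous f & continuous g].

(* Only the topology of T matters: a given metric on T need not be complete. *)
Definition polish (R : realType) (T : topologicalType) : Prop :=
  exists2 S : completeMetricType R, separable S & homeomorphic T S.

Definition closed_order disp (R : realType) (E : porderPMetricType disp R) :
    Prop :=
  closed [set p : E * E | (p.1 <= p.2)%O].

(* T with its Borel sigma-algebra *)
Notation borel T := (g_sigma_algebraType (@open T)).

(* nu_t -> mu weakly as t -> +oo *)
Definition weak_cvg (R : realType) (E : ptopologicalType)
    (nu : R -> set (borel E) -> \bar R) (mu : set (borel E) -> \bar R) : Prop :=
  forall f : E -> R, continuous f -> bounded_fun f ->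
    (\int[nu t]_(y in [set: borel E]) (f y)%:E)%E @[t --> +oo] -->
    (\int[mu]_(y in [set: borel E]) (f y)%:E)%E.

Definition cvg_in_probability d (Omega : measurableType d) (R : realType)
    (P : probability Omega R) (E : metricType R)
    (Y : R -> Omega -> E) (Z : Omega -> E) : Prop :=
  forall eps : R, 0 < eps ->
    P [set w | eps <= mdist (Y t w) (Z w)] @[t --> +oo] --> 0%E.

Record metric_dynamical_system d (Omega : measurableType d) (R : realType)
    (P : probability Omega R) (theta : R -> Omega -> Omega) : Prop := {
  mds_measurable :
    measurable_fun setT (fun p : R * Omega => theta p.1 p.2) ;
  mds_zero : forall w, theta 0 w = w ;
  mds_add : forall (s t : R) w, theta (s + t) w = theta s (theta t w) ;
  mds_invariant : forall (t : R) (A : set Omega), measurable A ->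
    P (theta t @^-1` A) = P A
}.

(* Time R_+ is encoded by restricting every condition to nonnegative times;
   the values of phi at negative times are irrelevant. *)
Record random_dynamical_system d (Omega : measurableType d) (R : realType)
    (E : ptopologicalType) (theta : R -> Omega -> Omega)
    (phi : R -> Omega -> E -> E) : Prop := {
  rds_measurable :
    measurable_fun [set p : R * (Omega * borel E) | 0 <= p.1]
      (fun p => phi p.1 p.2.1 p.2.2 : borel E) ;
  rds_zero : forall w x, phi 0 w x = x ;
  rds_cocycle : forall (t s : R) w x, 0 <= t -> 0 <= s ->
    phi (t + s) w x = phi t (theta s w) (phi s w x) ;
  rds_continuous : forall (s : R) w, 0 <= s -> continuous (phi s w)
}.

Definition order_preserving (Omega : Type) disp (R : realType)
    (E : porderType disp) (phi : R -> Omega -> E -> E) : Prop :=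
  forall (t : R) w (x y : E), 0 <= t -> (x <= y)%O -> (phi t w x <= phi t w y)%O.

Definition strongly_mixing d (Omega : measurableType d) (R : realType)
    (P : probability Omega R) (E : ptopologicalType)
    (phi : R -> Omega -> E -> E) (mu : probability (borel E) R) : Prop :=
  forall x : E,
    weak_cvg (fun t => pushforward P (fun w => phi t w x : borel E)) mu.

(* F_{s,t}, for s <= t *)
Definition filtration (Omega : Type) (R : realType) (E : ptopologicalType)
    (theta : R -> Omega -> Omega) (phi : R -> Omega -> E -> E) (s t : R) :
    set (set Omega) :=
  <<s [set A | exists (h : R) (x : E) (B : set (borel E)),
         [/\ 0 <= h <= t - s, measurable B &
             A = (fun w => phi h (theta s w) x) @^-1` B]] >>.

Definition past_generator (Omega : Type) (R : realType) (E : ptopologicalType)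
    (theta : R -> Omega -> Omega) (phi : R -> Omega -> E -> E) :
    set (set Omega) :=
  \bigcup_(s in [set s : R | s <= 0]) filtration theta phi s 0.

(* Omega with the sigma-algebra F_0 *)
Notation past theta phi :=
  (g_sigma_algebraType (past_generator theta phi)).

Definition rds_invariant d (Omega : measurableType d) (R : realType)
    (P : probability Omega R) (E : Type) (theta : R -> Omega -> Omega)
    (phi : R -> Omega -> E -> E) (a : Omega -> E) : Prop :=
  forall t : R, 0 <= t -> {ae P, forall w, phi t w (a w) = a (theta t w)}.

(* Main.v *)
Require Import Defs.
From HB Require Import structures.
From mathcomp Require Import all_boot all_order all_algebra.
From mathcomp Require Import all_classical all_reals all_analysis.
From mathcomp Require Import measurable_realfun lra.
Set Implicit Arguments.
Unset Strict Implicit.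
Unset Printing Implicit Defensive.
Import Order.TTheory GRing.Theory Num.Theory.
Import numFieldNormedType.Exports.
Local Open Scope classical_set_scope.
Local Open Scope ring_scope.

(** Write psi_t^x(w) = phi_t(theta_{-t} w, x) for the pullback flow. Its law is
that of phi_t(., x), hence converges to mu. The point is that psi_t^x is Cauchy
in probability as t grows, with a limit that does not depend on x.

The order enters through one principle. If X and Z have the same law mu and
X <= Z, then for every up-set U the event X in U is contained in Z in U and both
have probability mu(U), so they agree almost surely; since the order is closed,
countably many up-sets separate points, and X = Z. Any Y with X <= Y <= Z is then
equal to X too, although order intervals need not be small in the metric.
[order_squeeze] is the asymptotic form of this principle, for sequences whose laws
converge to mu and for Y that is only approximately between X and Z. It is proved
without passing to limits of joint laws: weakly convergent laws on a Polish space
are uniformly tight ([law_cvg_tight]), so up-sets generated by compact sets and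
compactness arguments suffice, together with the comparison of two integrals of
continuous functions of the distance to the up-set ([upset_crossing_near]).

Let f <= g with mu([f, g]) >= 1 - e. The flow started at z at time 0 need never
enter [f, g], as weak convergence says nothing about closed sets with empty
interior. It does however come close to a compact part of [f, g], and phi_t is
uniformly continuous near this compact set up to a small probability; so after
a further time t it is close to a point between the images of f and g
([eventually_near_interval]). By the principle it is then close to the image of f,
with an error that is uniform in the starting time
([eventually_close_to_endpoint]). Comparing psi_u^z and psi_u'^z' with the same
psi_t^f shows that they are close for all large u and u' ([pullback_cauchy]).

Along a fast sequence of times psi^z is almost surely a Cauchy sequence by
Borel-Cantelli. The given metric need not be complete, but by tightness the
sequence visits some compact set infinitely often, so it converges; the limit a is
measurable for the past because all psi_t^z are ([pullback_limit]). Convergence in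
probability for all starting points follows from [pullback_cauchy], and invariance
from phi_t(w, psi_s^z(w)) = psi_{t+s}^z(theta_t w) and continuity of phi_t. *)

(** * Distance to a set, level sets and Borel measurability *)

Section infdist.
Context (R : realType) (T : metricType R).
Implicit Types (A : set T) (x y : T).

Definition infdist A x : R := inf [set mdist x a | a in A].

Lemma infdist_le A x a : A a -> infdist A x <= mdist x a.
Proof.
move=> Aa; apply: ge_inf; last by exists a.
by exists 0 => _ [b _ <-]; exact: mdist_ge0.
Qed.

Lemma infdist_ge0 A x : 0 <= infdist A x.
Proof.
have [->|/set0P[a Aa]] := eqVneq A set0; first by rewrite /infdist image_set0 inf0.
apply: lb_le_inf; first by exists (mdist x a), a.
by move=> _ [b _ <-]; exact: mdist_ge0.
Qed.

Lemma infdist_lt A x r : A !=set0 -> infdist A x < r ->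
  exists2 a, A a & mdist x a < r.
Proof.
move=> [a Aa] /inf_lt[|_ [b Ab <-] br]; last by exists b.
by exists (mdist x a), a.
Qed.

Lemma infdist_lip A x y : A !=set0 ->
  infdist A x <= mdist x y + infdist A y.
Proof.
move=> A0; apply/ler_addgt0Pr => e e0.
have [|a Aa ya] := @infdist_lt A y (infdist A y + e) A0; first by rewrite ltrDl.
apply: le_trans (infdist_le x Aa) _.
by apply: le_trans (metric_triangle x y a) _; rewrite -addrA lerD2l ltW.
Qed.

Lemma infdist_in A x : A x -> infdist A x = 0.
Proof.
move=> Ax; apply/eqP; rewrite eq_le infdist_ge0 andbT.
by rewrite -(mdistxx x) infdist_le.
Qed.

Lemma closed_infdist0 A x : closed A -> A !=set0 -> infdist A x = 0 -> A x.
Proof.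
move=> cA A0 xA; apply: cA => B /nbhs_ballP[r /= r0 rB].
have [|a Aa xa] := @infdist_lt A x r A0; first by rewrite xA.
by exists a; split => //; apply: rB; rewrite ballEmdist.
Qed.

Lemma infdist_continuous A : A !=set0 -> continuous (infdist A).
Proof.
move=> A0 x; apply/cvgrPdist_lt => e e0; near=> y.
have xy : mdist x y < e.
  near: y; apply/metricType_numDomainType.nbhs_mdistP.
  by exists e.
have := infdist_lip x y A0; have := infdist_lip y x A0.
rewrite (metric_sym y x) => *.
by rewrite ltr_distl; apply/andP; split; lra.
Unshelve. all: by end_near. Qed.

End infdist.

Section level_sets.
Context (R : realType) d (T : measurableType d).
Implicit Types (f : T -> R) (b : R).

Lemma measurable_set_ge f b : measurable_fun setT f -> measurable [set x | b <= f x].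
Proof.
move=> mf; have := mf measurableT _ (measurable_itv `[b, +oo[); rewrite setTI.
by congr measurable; apply/seteqP; split => x /=; rewrite in_itv/= andbT.
Qed.

Lemma measurable_set_gt f b : measurable_fun setT f -> measurable [set x | b < f x].
Proof.
move=> mf; have := mf measurableT _ (measurable_itv `]b, +oo[); rewrite setTI.
by congr measurable; apply/seteqP; split => x /=; rewrite in_itv/= andbT.
Qed.

Lemma measurable_set_lt f b : measurable_fun setT f -> measurable [set x | f x < b].
Proof.
move=> mf; have := mf measurableT _ (measurable_itv `]-oo, b[); rewrite setTI.
by congr measurable; apply/seteqP; split => x /=; rewrite in_itv.
Qed.

End level_sets.

Section borel.
Context (R : realType).

Lemma continuous_borel_measurable (E : ptopologicalType) (h : E -> R) :
  continuous h -> measurable_fun [set: borel E] (h : borel E -> R).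
Proof.
move=> /continuousP ch.
apply: (measurability _ (RGenOpens.measurableE R)).
move=> _ [_ [a [b ->] <-]]; rewrite setTI; apply: sub_sigma_algebra.
exact/ch/interval_open.
Qed.

Lemma open_borel (E : ptopologicalType) (O : set E) : open O ->
  measurable (O : set (borel E)).
Proof. by move=> oO; exact: sub_sigma_algebra. Qed.

Lemma closed_borel (E : ptopologicalType) (F : set E) : closed F ->
  measurable (F : set (borel E)).
Proof.
move=> cF; rewrite -(setCK F); apply: measurableC; apply: open_borel.
exact: closed_openC.
Qed.

Context (E : pmetricType R).

Lemma compact_borel (K : set E) : compact K -> measurable (K : set (borel E)).
Proof.
by move=> cK; apply: closed_borel; apply: compact_closed => //; exact: metric_hausdorff.
Qed.

(** Without separability the distance need not be measurable for the product of the
Borel sigma-algebras. Separability gives it at once: the distance of x and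
y is below c exactly when some point of a dense sequence is at distance below q from x
and below c - q from y, with q rational. *)
Lemma mdist_measurable (dn : nat -> E) (ddn : dense (range dn))
   d (W : measurableType d) (X Y : W -> borel E) :
  measurable_fun setT X -> measurable_fun setT Y ->
  measurable_fun setT (fun w => mdist (X w : E) (Y w)).
Proof.
move=> mX mY; apply: (measurability _ (RGenInftyO.measurableE R)).
move=> _ [_ [c ->] <-]; rewrite setTI.
have cm (a : E) : continuous (mdist^~ a).
  have -> : mdist^~ a = infdist [set a].
    apply/funext => x; rewrite /infdist.
    by rewrite image_set1 inf1.
  by apply: infdist_continuous; exists a.
rewrite (_ : _ @^-1` _ = \bigcup_n \bigcup_q
   ((fun w => mdist (X w : E) (dn n)) @^-1` `]-oo, (ratr q : R)[ `&`
    (fun w => mdist (Y w : E) (dn n)) @^-1` `]-oo, (c - ratr q : R)[)).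
  apply: bigcupT_measurable => n; apply: bigcupT_measurable_rat => q.
  by apply: measurableI; rewrite -[X in measurable X]setTI;
    apply: (measurableT_comp (continuous_borel_measurable (cm (dn n)))) => //;
    exact: measurable_itv.
apply/seteqP; split => [w|w]/=; last first.
  move=> [n _ [q _ []]] /=; rewrite !in_itv/= => Xq Yq.
  have := metric_triangle (X w : E) (dn n) (Y w).
  by rewrite (metric_sym (dn n)); lra.
rewrite in_itv/= => XYc.
have e0 : 0 < (c - mdist (X w : E) (Y w)) / 3 by lra.
set e := _ / 3 in e0.
have [|x [/= Xe [n _ nx]]] := ddn (interior (ball (X w : E) e)) _ (@open_interior _ _).
  by exists (X w); exact/nbhsx_ballx.
rewrite -{}nx {x} in Xe.
have {}Xe := @interior_subset _ _ _ Xe; rewrite ballEmdist/= in Xe.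
have [q] := @rat_in_itvoo R (mdist (X w : E) (dn n)) (mdist (X w : E) (dn n) + e) ltac:(lra).
rewrite in_itv/= => /andP[q1 q2].
exists n => //; exists q => //=; rewrite !in_itv/=; split => //.
have := metric_triangle (Y w : E) (X w) (dn n).
rewrite (metric_sym (Y w : E) (X w)) => tr.
have : e * 3 = c - mdist (X w : E) (Y w) by rewrite /e; lra.
lra.
Qed.

End borel.

(** * Outer probability bounds and weak convergence of laws *)

Section outer_le.
Context (R : realType) d (Omega : measurableType d) (P : probability Omega R).
Implicit Types (S T : set Omega) (e : R).

(** Many events below quantify over uncountably many points, and nothing ensures
that they are measurable. Bounding the probability of a measurable superset makes union
bounds available for them. *)
Definition outer_le S e : Prop :=
  exists M, [/\ measurable M, S `<=` M & (P M <= e%:E)%E].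

Lemma outer_le_sub S T e : S `<=` T -> outer_le T e -> outer_le S e.
Proof. by move=> ST [M [mM TM Me]]; exists M; split => //; exact: subset_trans TM. Qed.

Lemma outer_leW S e e' : e <= e' -> outer_le S e -> outer_le S e'.
Proof.
by move=> ee [M [mM SM Me]]; exists M; split => //; rewrite (le_trans Me)// lee_fin.
Qed.

Lemma outer_leU S T e e' : outer_le S e -> outer_le T e' ->
  outer_le (S `|` T) (e + e').
Proof.
move=> [M [mM SM Me]] [N [mN TN Ne]]; exists (M `|` N); split.
- exact: measurableU.
- exact: setUSS.
- by rewrite EFinD; apply: le_trans (measureU2 _ mM mN) (leeD Me Ne).
Qed.

Lemma outer_le_measurable S e : measurable S -> outer_le S e -> (P S <= e%:E)%E.
Proof.
by move=> mS [M [mM SM Me]]; apply: le_trans Me; apply: le_measure => //; rewrite inE.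
Qed.

Lemma measurable_outer_le S e : measurable S -> (P S <= e%:E)%E -> outer_le S e.
Proof. by move=> mS Se; exists S; split. Qed.

Lemma outer_le0 e : 0 <= e -> outer_le set0 e.
Proof. by move=> e0; apply: measurable_outer_le => //; rewrite measure0 lee_fin. Qed.

End outer_le.

Section ramp.
Context (R : realType).

Definition ramp (a b t : R) : R := Num.min 1 (Num.max 0 ((b - t) / (b - a))).

Lemma ramp01 a b t : 0 <= ramp a b t <= 1.
Proof.
by rewrite /ramp ge_min lexx/= le_min ler01/= le_max lexx.
Qed.

Lemma ramp1 a b t : a < b -> t <= a -> ramp a b t = 1.
Proof.
move=> ab ta; apply/min_idPl; rewrite le_max ler_pdivlMr ?subr_gt0//.
by apply/orP; right; lra.
Qed.

Lemma ramp0 a b t : a < b -> b <= t -> ramp a b t = 0.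
Proof.
move=> ab bt; rewrite /ramp max_l ?min_r//.
by rewrite ler_pdivrMr ?subr_gt0// mul0r; lra.
Qed.

Lemma ramp_continuous a b (T : topologicalType) (h : T -> R) :
  continuous h -> continuous (fun x => ramp a b (h x)).
Proof.
move=> ch x; rewrite /continuous_at/ramp.
apply: (@continuous_min _ _ (fun=> 1) (fun x => Num.max 0 ((b - h x) / (b - a)))).
  exact: cvg_cst.
apply: (@continuous_max _ _ (fun=> 0) (fun x => (b - h x) / (b - a))).
  exact: cvg_cst.
by apply: cvgMl; apply: cvgB; [exact: cvg_cst|exact: ch].
Qed.

End ramp.

Section law_cvg.
Context (R : realType) d (Omega : measurableType d) (P : probability Omega R).

Lemma integral01_fin_num (v : Omega -> R) : measurable_fun setT v ->
  (forall w, 0 <= v w <= 1) -> (\int[P]_w (v w)%:E)%E \is a fin_num.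
Proof.
move=> mv v01; rewrite ge0_fin_numE; last first.
  by apply: integral_ge0 => w _; rewrite lee_fin; case/andP: (v01 w).
apply: (@le_lt_trans _ _ (\int[P]_w (cst 1%E w))%E).
  apply: ge0_le_integral => //.
  - by move=> w _; rewrite lee_fin; case/andP: (v01 w).
  - exact/measurable_EFinP.
  - by move=> w _; rewrite lee_fin; case/andP: (v01 w).
by rewrite integral_cst//= probability_setT mul1e ltry.
Qed.

Context (E : pmetricType R).
Implicit Types (X : nat -> Omega -> borel E) (mu : probability (borel E) R).

(** Test functions with values in [0, 1] suffice, and they keep all integrals
finite and nonnegative. *)
Definition law_cvg X mu : Prop :=
  forall u : E -> R, continuous u -> (forall x, 0 <= u x <= 1) ->
    (\int[P]_w (u (X n w))%:E)%E @[n --> \oo] -->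
    (\int[mu]_(y in [set: borel E]) (u y)%:E)%E.

Lemma law_cvg_near X mu (u : E -> R) e : law_cvg X mu ->
  continuous u -> (forall x, 0 <= u x <= 1) -> 0 < e ->
  \forall n \near \oo,
    (\int[P]_w (u (X n w))%:E <=
       \int[mu]_(y in [set: borel E]) (u y)%:E + e%:E)%E /\
    (\int[mu]_(y in [set: borel E]) (u y)%:E <=
       \int[P]_w (u (X n w))%:E + e%:E)%E.
Proof.
move=> Xmu cu u01 e0; have := Xmu u cu u01.
set I := (\int[mu]_(y in _) _)%E.
have /fineK <- : I \is a fin_num.
  rewrite ge0_fin_numE; last first.
    by apply: integral_ge0 => w _; rewrite lee_fin; case/andP: (u01 w).
  apply: (@le_lt_trans _ _ (\int[mu]_(w in setT) (cst 1%E w))%E).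
    apply: ge0_le_integral => //.
    - by move=> w _; rewrite lee_fin; case/andP: (u01 w).
    - by apply/measurable_EFinP; exact: (continuous_borel_measurable cu).
    - by move=> w _; rewrite lee_fin; case/andP: (u01 w).
  by rewrite integral_cst//= probability_setT mul1e ltry.
move=> /fine_cvgP[fin /cvgrPdist_le/(_ _ e0) near_e].
near=> n.
have /fineK <- : (\int[P]_w (u (X n w))%:E)%E \is a fin_num by near: n.
have : `|fine I - fine (\int[P]_w (u (X n w))%:E)%E| <= e by near: n.
by rewrite -!EFinD !lee_fin ler_distl => /andP[? ?]; split; lra.
Unshelve. all: by end_near. Qed.

(** The event h >= b and the event h > a are separated by a continuous ramp
of h, whose expectations converge. *)
Lemma portmanteau X mu (h : E -> R) (a b e : R) :
  (forall n, measurable_fun setT (X n)) -> law_cvg X mu ->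
  continuous h -> a < b -> 0 < e ->
  \forall n \near \oo, (P [set w | (b <= h (X n w))%R] <=
     mu ([set y | (a < h y)%R] : set (borel E)) + e%:E)%E.
Proof.
move=> mX Xmu ch ab e0.
have ab' : - b < - a by rewrite ltrN2.
pose u y := ramp (- b) (- a) (- h y).
have cu : continuous u.
  by apply: ramp_continuous => x; apply: cvgN; exact: ch.
have u01 x : 0 <= u x <= 1 by exact: ramp01.
have mu_ : measurable_fun [set: borel E] u by exact: continuous_borel_measurable.
have mh := continuous_borel_measurable ch.
have := law_cvg_near Xmu cu u01 e0; apply: filterS => n [le1 _].
have mA : measurable [set w | b <= h (X n w)].
  by apply: measurable_set_ge; exact: (measurableT_comp mh (mX n)).
have mB : measurable ([set y | a < h y] : set (borel E)).
  exact: measurable_set_gt.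
apply: (@le_trans _ _ (\int[P]_w (u (X n w))%:E)%E).
  rewrite -[X in (P X)%E]setIT -integral_indic//.
  apply: ge0_le_integral => //.
  - by apply/measurable_EFinP; exact: measurable_indic.
  - by apply/measurable_EFinP; exact: (measurableT_comp mu_ (mX n)).
  - move=> w _; rewrite lee_fin indicE; have [|_] := boolP (_ \in _).
      by rewrite inE/= => bh; rewrite /u ramp1 ?lerN2.
    by case/andP: (u01 (X n w)).
apply: le_trans le1 _; rewrite leeD2r//.
rewrite -[X in (mu X)%E]setIT -integral_indic//.
apply: ge0_le_integral => //.
- by move=> w _; rewrite lee_fin; case/andP: (u01 w).
- exact/measurable_EFinP.
- by apply/measurable_EFinP; exact: measurable_indic.
- move=> w _; rewrite lee_fin indicE; have [|] := boolP (_ \in _).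
    by move=> _; case/andP: (u01 w).
  by rewrite notin_setE/= => /negP; rewrite -leNgt => ha; rewrite /u ramp0 ?lerN2.
Qed.

End law_cvg.

(** * Uniform tightness of weakly convergent sequences *)

Section probability_continuity.
Context (R : realType) d (T : measurableType d) (P : probability T R).

Lemma nonincreasing_prob_near (F : nat -> set T) e :
  (forall n, measurable (F n)) -> nonincreasing_seq F -> 0 < e ->
  \forall n \near \oo, (P (F n) <= P (\bigcap_n F n) + e%:E)%E.
Proof.
move=> mF niF e0.
have mI : measurable (\bigcap_n F n) by exact: bigcapT_measurable.
have : P \o F @ \oo --> P (\bigcap_n F n).
  apply: nonincreasing_cvg_mu => //.
  by rewrite (le_lt_trans (probability_le1 P (mF 0%N)))// ltry.
have fI := fin_num_measure P _ mI; rewrite -(fineK fI).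
move=> /fine_cvgP[_ /cvgrPdist_le/(_ _ e0)]; apply: filterS => n /=.
have fn := fin_num_measure P _ (mF n); rewrite -(fineK fn) -EFinD lee_fin/=.
by rewrite ler_distl => /andP[? ?]; lra.
Qed.

Lemma nondecreasing_probC_near (F : nat -> set T) e :
  (forall n, measurable (F n)) -> nondecreasing_seq F ->
  \bigcup_n F n = setT -> 0 < e ->
  \forall n \near \oo, (P (~` F n) <= e%:E)%E.
Proof.
move=> mF ndF FT e0.
have := @nonincreasing_prob_near (fun n => ~` F n) e.
rewrite -setC_bigcup FT setCT measure0.
under eq_near do rewrite add0e; apply => //.
  by move=> n; exact: measurableC.
by move=> m n mn; apply/subsetPset; apply: subsetC; apply/subsetPset/ndF.
Qed.

End probability_continuity.

Section totally_bounded.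
Context (R : realType).

Lemma ultra_bigcup T (F : set_system T) (B : nat -> set T) m :
  UltraFilter F -> F (\bigcup_(i < m) B i) -> exists i, F (B i).
Proof.
move=> UF; elim: m => [|m IH].
  rewrite bigcup_mkord big_ord0 => F0; exfalso.
  exact: (@filter_not_empty _ F _).
rewrite bigcup_mkord big_ord_recr/= -bigcup_mkord => FU.
have [Fm|Fm] := in_ultra_setVsetC (B m) UF; first by exists m.
apply: IH; apply: filterS (filterI FU Fm).
by move=> x [[]//].
Qed.

(** Every ultrafilter on a totally bounded set contains balls of all radii, hence is
Cauchy, and completeness provides its limit. *)
Lemma totally_bounded_compact (S : completeMetricType R) (A : set S) :
  closed A ->
  (forall e : R, 0 < e -> exists (c : nat -> S) m,
     A `<=` \bigcup_(i < m) [set x | mdist (c i) x < e]) ->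
  compact A.
Proof.
move=> cA tA; rewrite compact_ultra => F UF FA.
have Fc : cauchy F.
  apply: cauchy_exP => e e0; have [c [m Am]] := tA _ e0.
  have [i Fi] := ultra_bigcup UF (filterS Am FA).
  by exists (c i); rewrite ballEmdist.
have PF : ProperFilter F by exact: ultra_proper.
have Fl : F --> lim F := @cauchy_cvg _ F PF Fc.
exists (lim F); split => //; apply: cA => B /Fl FB.
exact: filter_ex (filterI FA FB).
Qed.

End totally_bounded.

Section tightness.
Context (R : realType).

Lemma separable_dense_seq (T : ptopologicalType) : separable T ->
  exists c : nat -> T, dense (range c).
Proof.
move=> [D /countable_injP[f finj] dD].
have /choice[c cP] : forall n, exists x, forall y, D y -> f y = n -> x = y.
  move=> n; have [[x [Dx xn]]|no] := pselect (exists x, D x /\ f x = n).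
    by exists x => y Dy yn; apply: finj; rewrite ?inE// yn.
  by exists point => y Dy yn; exfalso; apply: no; exists y.
exists c => O O0 oO; have [x [Ox Dx]] := dD O O0 oO.
by exists x; split => //; exists (f x) => //; exact: cP.
Qed.

Lemma polish_dense_seq (E : pmetricType R) : polish R E ->
  exists c : nat -> E, dense (range c).
Proof.
move=> [S /separable_dense_seq[c dc] [e [g [eg ge ce cg]]]].
exists (g \o c) => O [x Ox] oO.
have [|y [Oy [n _ ny]]] := dc (g @^-1` O) _ (open_comp (in1W cg) oO).
  by exists (e x); rewrite /= eg.
by exists (g y); split => //; exists n => //=; rewrite ny.
Qed.

Section law_cvg_tight.
Context d (Omega : measurableType d) (P : probability Omega R)
  (E : pmetricType R) (X : nat -> Omega -> borel E)
  (mu : probability (borel E) R).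
Hypotheses (mX : forall n, measurable_fun setT (X n)) (Xmu : law_cvg P X mu).

(** With h m the distance to the first m points of a dense sequence, this bounds the
mass far from a finite set uniformly in n. For large n it comes from the limit law, and
each of the finitely many remaining laws is handled by continuity from above. *)
Lemma uniformly_small_levels (h : nat -> E -> R) (r e : R) :
  (forall m, continuous (h m)) -> (forall m x, h m.+1 x <= h m x) ->
  (forall x, exists m, h m x <= r) -> 0 < r -> 0 < e ->
  exists m, forall n, (P [set w | (2 * r <= h m (X n w))%R] <= e%:E)%E.
Proof.
move=> ch hS hr r0 e0.
have hle x m m' : (m <= m')%N -> h m' x <= h m x.
  move=> /subnK <-; elim: (m' - m)%N => // k IH.
  by rewrite addSn; apply: le_trans IH.
have mh m : measurable_fun setT (h m : borel E -> R).
  exact: continuous_borel_measurable.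
have mhX m n : measurable_fun setT (fun w => h m (X n w)).
  exact: (measurableT_comp (mh m) (mX n)).
have mbad m n : measurable [set w | (2 * r <= h m (X n w))%R].
  exact: measurable_set_ge.
have bad_le m m' n e' : (m <= m')%N ->
    (P [set w | (2 * r <= h m (X n w))%R] <= e')%E ->
    (P [set w | (2 * r <= h m' (X n w))%R] <= e')%E.
  move=> mm'; apply: le_trans; apply: le_measure; rewrite ?inE//.
  by move=> w /= /le_trans; apply; exact: hle.
have e20 : 0 < e / 2 by rewrite divr_gt0.
have [m0 m0P] : exists m0,
    (mu ([set y | (r < h m0 y)%R] : set (borel E)) <= (e / 2)%:E)%E.
  have := @nondecreasing_probC_near _ _ _ mu (fun m => ~` [set y | r < h m y]) (e / 2).
  case => //.
  - by move=> m; apply: measurableC; exact: measurable_set_gt.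
  - move=> m m' mm'; apply/subsetPset => x /= /negP; rewrite -leNgt => hx.
    by apply/negP; rewrite -leNgt; apply: le_trans hx; exact: hle.
  - apply/seteqP; split => // x _; have [m hm] := hr x.
    by exists m => //=; apply/negP; rewrite -leNgt.
  - by move=> m _ /(_ _ (leqnn m))/=; rewrite setCK; exists m.
have [N _ NP] : \forall n \near \oo, (P [set w | (2 * r <= h m0 (X n w))%R] <= e%:E)%E.
  have := portmanteau mX Xmu (ch m0) (_ : r < 2 * r) e20.
  move=> /(_ ltac:(lra)); apply: filterS => n /le_trans; apply.
  by rewrite [in leRHS](splitr e) EFinD leeD2r.
have single n : \forall m \near \oo, (P [set w | (2 * r <= h m (X n w))%R] <= e%:E)%E.
  have := @nondecreasing_probC_near _ _ _ P (fun m => ~` [set w | 2 * r <= h m (X n w)]) e.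
  case => //.
  - by move=> m; exact: measurableC.
  - move=> m m' mm'; apply/subsetPset => w /= /negP; rewrite -ltNge => hx.
    by apply/negP; rewrite -ltNge; apply: le_lt_trans hx; exact: hle.
  - apply/seteqP; split => // w _; have [m hm] := hr (X n w).
    by exists m => //=; apply/negP; rewrite -ltNge; apply: le_lt_trans hm _; lra.
  - by move=> m _ mP; exists m => // k /mP/=; rewrite setCK.
have [m1 m1P] : exists m, forall n, (n < N)%N ->
    (P [set w | (2 * r <= h m (X n w))%R] <= e%:E)%E.
  elim: N {NP} => [|N [m IH]]; first by exists 0%N.
  have [m' _ m'P] := single N; exists (maxn m m') => n.
  rewrite ltnS leq_eqVlt => /predU1P[->|/IH]; first exact/m'P/leq_maxr.
  exact/bad_le/leq_maxl.
exists (maxn m0 m1) => n; have [nN|Nn] := ltnP n N.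
  exact: bad_le (leq_maxr _ _) (m1P _ nN).
exact: bad_le (leq_maxl _ _) (NP _ Nn).
Qed.

(** The compact set is an intersection of finite unions of balls with radii tending
to 0, with a geometric budget for the mass that is lost at each radius. Radii are
measured in the complete metric of the homeomorphic copy of E, which is where
completeness enters. *)
Lemma law_cvg_tight (e : R) : polish R E -> 0 < e ->
  exists2 K : set E, compact K & forall n, (P (X n @^-1` ~` K) <= e%:E)%E.
Proof.
move=> [S /separable_dense_seq[c dc] [f [g [fg gf cf cg]]]] e0.
pose D m := [set c i | i in `I_m.+1].
have D0 m : D m !=set0 by exists (c 0%N), 0%N.
pose h m x := infdist (D m) (f x).
have ch m : continuous (h m).
  move=> x; apply: (@continuous_comp _ _ _ f (infdist (D m))); first exact: cf.
  exact: infdist_continuous.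
have hS m x : h m.+1 x <= h m x.
  apply: le_inf => //; last 2 first.
  - by exists (mdist (f x) (c 0%N)), (c 0%N) => //; exists 0%N.
  - by split; [exists (mdist (f x) (c 0%N)), (c 0%N) => //; exists 0%N
             |exists 0 => _ [b _ <-]; exact: mdist_ge0].
  move=> _ [_ [_ [i im <-] <-] <-].
  exists (- mdist (f x) (c i)); split => //.
  exists (mdist (f x) (c i)) => //; exists (c i) => //; exists i => //=.
  exact: ltnW.
pose r k : R := k.+1%:R^-1.
have r0 k : 0 < r k by rewrite invr_gt0.
have hr k x : exists m, h m x <= r k.
  have [|y [By [i _ iy]]] := dc (interior (ball (f x) (r k))) _ (@open_interior _ _).
    by exists (f x); exact/nbhsx_ballx.
  exists i; have {}By := @interior_subset _ _ _ By.
  rewrite ballEmdist/= -iy in By.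
  by apply: le_trans (infdist_le _ _) (ltW By); exists i => /=.
have /choice[m mP] : forall k, exists m, forall n,
    (P [set w | (2 * r k <= h m (X n w))%R] <= (e / (2 ^ k.+1)%:R)%:E)%E.
  move=> k; apply: uniformly_small_levels => //.
  by rewrite divr_gt0// ltr0n expn_gt0.
pose KS := \bigcap_k [set s | infdist (D (m k)) s <= 2 * r k].
have cKS : closed KS.
  apply: closed_bigI => k _.
  rewrite (_ : [set _ | _] = infdist (D (m k)) @^-1` [set t | t <= 2 * r k])//.
  apply: preimage_closed; last exact: closed_le.
  by move=> x _; exact: infdist_continuous.
have cpKS : compact KS.
  apply: totally_bounded_compact => // eps eps0.
  have [k kP] : exists k, 2 * r k < eps.
    have e2 : 0 < eps / 2 by rewrite divr_gt0.
    have [k _ /(_ _ (leqnn k))/= ke] := near_infty_natSinv_lt (PosNum e2).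
    by exists k; rewrite mulrC -ltr_pdivlMr.
  exists c, (m k).+1 => s /(_ k I)/= /le_lt_trans/(_ kP).
  move=> /infdist_lt[//|_ [i im <-]] sc; exists i => //=.
  by rewrite metric_sym.
have cpK : compact (g @` KS).
  by apply: continuous_compact => //; exact: continuous_subspaceT.
exists (g @` KS) => //.
move=> n.
have mbad k : measurable [set w | (2 * r k <= h (m k) (X n w))%R].
  apply: measurable_set_ge.
  exact: (measurableT_comp (continuous_borel_measurable (ch (m k))) (mX n)).
apply: (@le_trans _ _ (P (\bigcup_k [set w | (2 * r k <= h (m k) (X n w))%R]))).
  apply: le_measure; rewrite ?inE.
  - rewrite -[X in measurable X]setTI; apply: mX => //.
    by apply: measurableC; exact: compact_borel.
  - exact: bigcupT_measurable.
  - move=> w /= nK; apply: contrapT => nb; apply: nK.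
    exists (f (X n w)) => // k _ /=; rewrite leNgt; apply/negP => /ltW kb.
    by apply: nb; exists k.
apply: le_trans (epsilon_trick0 xpredT (ltW e0)).
apply: (@le_trans _ _ (\sum_(k <oo) P [set w | (2 * r k <= h (m k) (X n w))%R])%E).
  apply: measure_sigma_subadditive => //.
  exact: bigcupT_measurable.
by apply: lee_nneseries => // k _; exact: mP.
Qed.

End law_cvg_tight.
End tightness.

(** * Compactness and closed partial orders *)

Section compactness.
Context (R : realType).

(** A Lebesgue number argument: a property that holds near each point for all small
parameters holds for one parameter on a whole compact set. *)
Lemma compact_uniform_radius (T : pseudoMetricType R) (K : set T)
    (Q : R -> T -> Prop) : compact K ->
  (forall p, K p -> exists2 r : R, 0 < r &
     forall p' k, ball p r p' -> 0 < k < r -> Q k p') ->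
  exists2 k : R, 0 < k & forall p, K p -> Q k p.
Proof.
move=> /compact_near_coveringP cK loc.
have : \forall k \near 0^'+, K `<=` Q k.
  apply: cK => p /loc[r r0 rQ].
  exists (ball p r, [set k | 0 < k < r]) => /=; last by move=> [p' k] [/= ? ?]; exact: rQ.
  split; first exact: nbhsx_ballx.
  near=> k; apply/andP; split; near: k.
    exact: nbhs_right_gt.
  exact: nbhs_right_lt.
move=> near_k.
have pos : \forall k \near 0^'+, (0 : R) < k by exact: nbhs_right_gt.
have := @filter_ex _ _ (at_right_proper_filter 0) _ (filterI pos near_k).
by move=> [k [k0 kQ]]; exists k.
Unshelve. all: by end_near. Qed.

(** Properties of sets that are stable under subsets and finite unions pass from small
neighbourhoods to a compact set: otherwise the complements would generate a filter
without cluster point. *)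
Lemma compact_ideal (T : topologicalType) (C : set T) (Q : set T -> Prop) :
  compact C -> Q set0 -> (forall A B, A `<=` B -> Q B -> Q A) ->
  (forall A B, Q A -> Q B -> Q (A `|` B)) ->
  (forall x, C x -> exists2 N, nbhs x N & Q (N `&` C)) -> Q C.
Proof.
move=> cC Q0 Qsub QU loc; apply: contrapT => nQ.
pose F := [set A | Q (C `\` A)].
have FF : Filter F.
  split => [|A B|A B AB]; rewrite /F/=.
  - by rewrite setDT.
  - by move=> QA QB; rewrite setDE setCI setIUr; exact: QU.
  - by apply: Qsub; exact: setDS.
have PF : ProperFilter F.
  by apply: Build_ProperFilter; rewrite /F/= setD0.
have FC : F C by rewrite /F/= setDv.
have [x [Cx clx]] := cC F PF FC.
have [N Nx QN] := loc _ Cx.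
have FN : F (~` N) by rewrite /F/= setDE setCK setIC.
by have [y [/= ]] := clx _ _ FN Nx.
Qed.

End compactness.

Section closed_order.
Context (R : realType) (disp : Order.disp_t) (E : porderPMetricType disp R).
Hypothesis hle : closed_order E.

Lemma not_le_ball (x z : E) : ~ (x <= z)%O -> exists2 r : R, 0 < r &
  forall x' z', mdist x x' < r -> mdist z z' < r -> ~ (x' <= z')%O.
Proof.
move=> xz; have oE := closed_openC hle.
have /nbhs_ballP[r /= r0 rE] : nbhs (x, z) (~` [set p : E * E | (p.1 <= p.2)%O]).
  exact: open_nbhs_nbhs.
exists r => // x' z' xx' zz'; apply: (rE (x', z')).
by split; rewrite ballEmdist.
Qed.

Definition upset (U : set E) := forall x z, U x -> (x <= z)%O -> U z.

Definition upclosure (B : set E) := [set y | exists2 b, B b & (b <= y)%O].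

Lemma upclosure_upset B : upset (upclosure B).
Proof. by move=> x z [b Bb bx] xz; exists b => //; exact: le_trans xz. Qed.

Lemma subset_upclosure B : B `<=` upclosure B.
Proof. by move=> b Bb; exists b. Qed.

(** The up-closure of a merely closed set need not be closed, which is why up-sets
are generated by compact sets throughout. *)
Lemma upclosure_closed (B : set E) : compact B -> closed (upclosure B).
Proof.
move=> cB; rewrite -openC openE => y /= nBy.
have [|r r0 rP] := @compact_uniform_radius R E B
    (fun k b => forall y', mdist y y' < k -> ~ (b <= y')%O) cB.
  move=> b Bb; have /not_le_ball[r r0 rP] : ~ (b <= y)%O.
    by move=> le; apply: nBy; exists b.
  exists r => // b' k; rewrite ballEmdist/= => bb' /andP[k0 kr] y' yy'.
  by apply: rP => //; exact: lt_trans kr.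
apply/nbhs_ballP; exists r => // y'; rewrite ballEmdist/= => yy' [b Bb].
exact: rP.
Qed.

(** On a compact set an up-set absorbs small perturbations: an almost comparable
pair (x, z) with x almost in U has z almost in U. The intermediate point x' accounts for
order relations that hold only after moving x slightly, and x' itself need not lie in K. *)
Lemma order_compact_modulus (K U : set E) (dl : R) :
  compact K -> closed U -> upset U -> U !=set0 -> 0 < dl ->
  exists2 k : R, 0 < k & forall x x' z, K x -> K z -> mdist x x' < k ->
    (x' <= z)%O -> infdist U x < k -> infdist U z < dl.
Proof.
move=> cK cU uU U0 dl0.
have [|k k0 kP] := @compact_uniform_radius R (E * E)%type (K `*` K)
    (fun k p => forall x', mdist p.1 x' < k -> (x' <= p.2)%O ->
       infdist U p.1 < k -> infdist U p.2 < dl) (compact_setX cK cK).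
  move=> [x z] [/= Kx Kz].
  have [Uz|Uz] := ltP (infdist U z) dl.
    exists (dl - infdist U z); first by rewrite subr_gt0.
    move=> [x1 z1] k [] /=; rewrite !ballEmdist/= => _ zz1 _ x' _ _ _.
    have := infdist_lip z1 z U0; rewrite (metric_sym z1 z); lra.
  have [Ux|nUx] := pselect (U x).
    have /not_le_ball[r r0 rP] : ~ (x <= z)%O.
      move=> /(uU _ _ Ux)/infdist_in Uz0; move: Uz; rewrite Uz0.
      by rewrite leNgt dl0.
    exists (r / 2); first by rewrite divr_gt0.
    move=> [x1 z1] k [] /=; rewrite !ballEmdist/= => xx1 zz1 kr x' x1x' le.
    exfalso; apply: (rP x' z1) => //; last lra.
    have := metric_triangle x x1 x'; lra.
  have Ux0 : 0 < infdist U x.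
    rewrite lt_neqAle infdist_ge0 andbT; apply/eqP => /esym.
    by move=> /(closed_infdist0 cU U0).
  exists (infdist U x / 2); first by rewrite divr_gt0.
  move=> [x1 z1] k [] /=; rewrite !ballEmdist/= => xx1 _ kr x' _ _ Ux1.
  have := infdist_lip x x1 U0; lra.
by exists k => // x x' z Kx Kz; apply: (kP (x, z)).
Qed.

End closed_order.

(** * Squeezing between random elements with the same limit law *)

Section integral_comparison.
Context (R : realType) d (Omega : measurableType d) (P : probability Omega R).

(** Integrate the pointwise inequality 1_S + v <= u + 1_B. *)
Lemma prob_le_integral (S B : set Omega) (v u : Omega -> R) :
  measurable S -> measurable B -> measurable_fun setT v -> measurable_fun setT u ->
  (forall w, 0 <= v w <= 1) -> (forall w, 0 <= u w <= 1) ->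
  (forall w, S w -> v w = 0) -> (forall w, S w -> u w = 1) ->
  (forall w, ~ B w -> v w <= u w) ->
  (P S + \int[P]_w (v w)%:E <= \int[P]_w (u w)%:E + P B)%E.
Proof.
move=> mS mB mv mu v01 u01 Sv Su Bvu.
have iS A : measurable A -> P A = (\int[P]_w (\1_A w)%:E)%E.
  by move=> mA; rewrite integral_indic// setIT.
have mI A : measurable A -> measurable_fun setT (EFin \o (\1_A : Omega -> R)).
  by move=> mA; apply/measurable_EFinP; exact: measurable_indic.
have mE (f : Omega -> R) : measurable_fun setT f -> measurable_fun setT (EFin \o f).
  by move=> mf; exact/measurable_EFinP.
have v0 w : 0 <= v w by case/andP: (v01 w).
have u0 w : 0 <= u w by case/andP: (u01 w).
rewrite (iS S mS) (iS B mB) -!ge0_integralD//;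
  try solve [exact: mI|exact: mE|by move=> w _; rewrite lee_fin].
apply: ge0_le_integral => //.
- by move=> w _; rewrite adde_ge0// lee_fin.
- by apply: emeasurable_funD; [exact: mI|exact: mE].
- by apply: emeasurable_funD; [exact: mE|exact: mI].
- move=> w _; rewrite -!EFinD lee_fin !indicE.
  have := v01 w; have := u01 w.
  have [|] := boolP (w \in S).
    by rewrite inE => Sw; rewrite (Sv w Sw) (Su w Sw); case: (_ \in _) => /=; lra.
  move=> _; have [_|] := boolP (w \in B); first by rewrite /=; lra.
  by rewrite notin_setE => /Bvu; rewrite /=; lra.
Qed.

End integral_comparison.

Section order_limits.
Context (R : realType) (disp : Order.disp_t) (E : porderPMetricType disp R).
Hypotheses (hE : polish R E) (hle : closed_order E).
Context d (Omega : measurableType d) (P : probability Omega R)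
  (mu : probability (borel E) R).
Variables (X Z : nat -> Omega -> borel E).
Hypotheses (mX : forall n, measurable_fun setT (X n))
  (mZ : forall n, measurable_fun setT (Z n)).
Hypotheses (Xmu : law_cvg P X mu) (Zmu : law_cvg P Z mu).
Hypothesis XZ : forall n w, ((X n w : E) <= Z n w)%O.

(** If X is away from U while Z is near U, the ordered pair X <= Z crosses the boundary
of U upwards. Since no ordered pair crosses downwards, the probability of crossing is
controlled by the difference of the masses that the laws of Z and X give to small
neighbourhoods of U, and both laws tend to mu. *)
Lemma upset_crossing_near (U : set E) (eta e : R) :
  closed U -> upset U -> U !=set0 -> 0 < eta -> 0 < e ->
  exists2 dl : R, 0 < dl & \forall n \near \oo,
    outer_le P [set w | infdist U (Z n w : E) < dl /\ eta <= infdist U (X n w : E)] e.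
Proof.
(* two tightness errors, two integral errors and one error for mu *)
move=> cU uU U0 eta0 e0; pose e' := e / 5.
have e'0 : 0 < e' by rewrite divr_gt0.
have cdU := infdist_continuous U0.
have mdU : measurable_fun [set: borel E] (infdist U : borel E -> R).
  exact: continuous_borel_measurable.
have mdX n : measurable_fun setT (fun w => infdist U (X n w : E)).
  exact: (measurableT_comp mdU (mX n)).
have mdZ n : measurable_fun setT (fun w => infdist U (Z n w : E)).
  exact: (measurableT_comp mdU (mZ n)).
have [KX cKX KXP] := law_cvg_tight mX Xmu hE e'0.
have [KZ cKZ KZP] := law_cvg_tight mZ Zmu hE e'0.
pose K : set E := KX `|` KZ.
have cK : compact K by exact: compactU.
have mU : measurable (U : set (borel E)) by exact: closed_borel.
have mKX : measurable (KX : set (borel E)).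
  exact: compact_borel.
have mKZ : measurable (KZ : set (borel E)).
  exact: compact_borel.
have [N NP] : exists N, (mu [set y | (infdist U (y : E) < N.+1%:R^-1)%R] <=
    mu (U : set (borel E)) + e'%:E)%E.
  have := @nonincreasing_prob_near _ _ _ mu
    (fun n => [set y | infdist U (y : E) < n.+1%:R^-1]) e'.
  rewrite (_ : \bigcap_n _ = (U : set (borel E))); last first.
    apply/seteqP; split => [y yU|y Uy n _] /=; last by rewrite infdist_in.
    apply: closed_infdist0 => //; apply/eqP; rewrite eq_le infdist_ge0 andbT.
    apply/ler_addgt0Pl => r r0; rewrite addr0.
    have [k _ /(_ k (leqnn k))/= kr] := near_infty_natSinv_lt (PosNum r0).
    exact: ltW (lt_trans (yU k I) kr).
  case => //.
  - by move=> n; exact: measurable_set_lt.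
  - move=> m n mn; apply/subsetPset => y /= /lt_le_trans; apply.
    by rewrite lef_pV2 ?posrE// ler_nat ltnS.
  - by move=> m _ /(_ m (leqnn m))/= ?; exists m.
(* 2 dl = 1 / N.+1, so the integral of u2 below is at most mu U + e'. *)
pose dl : R := N.+1%:R^-1 / 2.
have dl0 : 0 < dl by rewrite divr_gt0// invr_gt0.
have [k0 k00 k0P] := order_compact_modulus hle cK cU uU U0 dl0.
(* The minimum with eta makes u1 vanish on the crossing event. *)
pose k := Num.min k0 eta.
have kgt0 : 0 < k by rewrite lt_min k00.
exists dl => //.
pose u1 y := ramp 0 k (infdist U y).
pose u2 y := ramp dl (2 * dl) (infdist U y).
have dl2 : dl < 2 * dl by lra.
have cu1 : continuous u1 by exact: ramp_continuous.
have cu2 : continuous u2 by exact: ramp_continuous.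
have u1_01 y : 0 <= u1 y <= 1 by exact: ramp01.
have u2_01 y : 0 <= u2 y <= 1 by exact: ramp01.
have mu1 : measurable_fun [set: borel E] (u1 : borel E -> R).
  exact: continuous_borel_measurable.
have mu2 : measurable_fun [set: borel E] (u2 : borel E -> R).
  exact: continuous_borel_measurable.
apply: filterS2 (law_cvg_near Xmu cu1 u1_01 e'0) (law_cvg_near Zmu cu2 u2_01 e'0).
move=> n [_ X1] [Z2 _].
have mS : measurable [set w | infdist U (Z n w : E) < dl /\ eta <= infdist U (X n w : E)].
  by apply: measurableI; [exact: measurable_set_lt|exact: measurable_set_ge].
apply: measurable_outer_le => //.
have mBX : measurable (X n @^-1` ~` KX).
  by rewrite -[X in measurable X]setTI; apply: mX => //; exact: measurableC.
have mBZ : measurable (Z n @^-1` ~` KZ).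
  by rewrite -[X in measurable X]setTI; apply: mZ => //; exact: measurableC.
have PB : (P (X n @^-1` (~` KX) `|` Z n @^-1` (~` KZ)) <= (e' + e')%:E)%E.
  by rewrite EFinD; apply: le_trans (measureU2 _ mBX mBZ) (leeD (KXP n) (KZP n)).
have mB := measurableU _ _ mBX mBZ.
have main : (P [set w | infdist U (Z n w : E) < dl /\ eta <= infdist U (X n w : E)]%R +
     \int[P]_w (u1 (X n w))%:E <=
   \int[P]_w (u2 (Z n w))%:E + P (X n @^-1` (~` KX) `|` Z n @^-1` (~` KZ)))%E.
  apply: prob_le_integral => //.
  - exact: (measurableT_comp mu1 (mX n)).
  - exact: (measurableT_comp mu2 (mZ n)).
  - by move=> w [_ Xw]; apply: ramp0 => //; apply: le_trans Xw; rewrite ge_min lexx orbT.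
  - by move=> w [Zw _]; apply: ramp1 => //; exact: ltW.
  - move=> w /not_orP[/= /contrapT KXw /contrapT KZw].
    have [kX|Xk] := leP k (infdist U (X n w : E)).
      by rewrite /u1 ramp0//; case/andP: (u2_01 (Z n w)).
    rewrite /u2 ramp1//; first by case/andP: (u1_01 (X n w)).
    apply/ltW/(k0P (X n w) (X n w)) => //; [by left|by right|by rewrite mdistxx|].
    by apply: lt_le_trans Xk _; rewrite ge_min lexx.
have I2 : (\int[mu]_(y in [set: borel E]) (u2 y)%:E <= mu (U : set (borel E)) + e'%:E)%E.
  apply: le_trans NP; rewrite -[X in (_ <= mu X)%E]setIT -integral_indic//; last first.
    exact: measurable_set_lt.
  apply: ge0_le_integral => //.
  - by move=> y _; rewrite lee_fin; case/andP: (u2_01 y).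
  - exact/measurable_EFinP.
  - apply/measurable_EFinP; apply: measurable_indic; exact: measurable_set_lt.
  - move=> y _; rewrite lee_fin indicE; have [|] := boolP (_ \in _).
      by move=> _; case/andP: (u2_01 y).
    rewrite notin_setE/= => /negP; rewrite -leNgt => yN; rewrite /u2 ramp0//.
    by rewrite /dl mulrC divfK.
have I1 : (mu (U : set (borel E)) <= \int[mu]_(y in [set: borel E]) (u1 y)%:E)%E.
  rewrite -[X in (mu X <= _)%E]setIT -integral_indic//.
  apply: ge0_le_integral => //.
  - by apply/measurable_EFinP; exact: measurable_indic.
  - exact/measurable_EFinP.
  - move=> y _; rewrite lee_fin indicE; have [|] := boolP (_ \in _).
      by rewrite inE => Uy; rewrite /u1 ramp1// infdist_in.
    by move=> _; case/andP: (u1_01 y).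
move: I1 I2 X1 Z2 PB main.
rewrite -(fineK (fin_num_measure P _ mS)) -(fineK (fin_num_measure P _ mB)).
rewrite -(fineK (fin_num_measure mu _ mU)).
rewrite -(fineK (integral01_fin_num mu mu1 u1_01)) -(fineK (integral01_fin_num mu mu2 u2_01)).
rewrite -(fineK (integral01_fin_num P (measurableT_comp mu1 (mX n)) (fun w => u1_01 (X n w)))).
rewrite -(fineK (integral01_fin_num P (measurableT_comp mu2 (mZ n)) (fun w => u2_01 (Z n w)))).
rewrite -!EFinD !lee_fin /e' => *; lra.
Qed.


(** A pair (x, y) at distance at least eta either violates x <= y, and so do all close
pairs, or violates y <= x by antisymmetry. In the second case a compact neighbourhood of
y generates an up-set U away from x; then Y in U forces Z near U while X stays away from
U, which is the unlikely crossing of [upset_crossing_near]. Finitely many such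
neighbourhoods cover the relevant compact set of pairs. *)
Lemma order_squeeze (Y : nat -> Omega -> borel E) (G : nat -> set Omega)
    (r : nat -> R) (eta e : R) :
  (forall n, measurable_fun setT (Y n)) -> law_cvg P Y mu ->
  r @ \oo --> 0 ->
  (forall n w, G n w -> exists y' : E,
     [/\ mdist (Y n w : E) y' <= r n, ((X n w : E) <= y')%O & (y' <= (Z n w : E))%O]) ->
  0 < eta -> 0 < e ->
  \forall n \near \oo,
    outer_le P (G n `&` [set w | eta <= mdist (X n w : E) (Y n w)]) e.
Proof.
move=> mY Ymu r_to_0 GP eta0 e0.
have r_lt k : 0 < k -> \forall n \near \oo, r n < k.
  move=> k0; have /cvgrPdist_lt/(_ _ k0) := r_to_0; apply: filterS => n.
  by rewrite sub0r normrN; exact: le_lt_trans (ler_norm _).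
have preim (W : nat -> Omega -> borel E) (K : set E) n :
    (forall n, measurable_fun setT (W n)) -> compact K -> measurable (W n @^-1` ~` K).
  move=> mW cK; rewrite -[X in measurable X]setTI; apply: mW => //.
  by apply: measurableC; exact: compact_borel.
have e40 : 0 < e / 3 by rewrite divr_gt0.
have [KX cKX KXP] := law_cvg_tight mX Xmu hE e40.
have [KY cKY KYP] := law_cvg_tight mY Ymu hE e40.
pose K : set E := KX `|` KY.
have cK : compact K by exact: compactU.
pose C := (K `*` K) `&` [set p : E * E | eta <= mdist p.1 p.2].
have cC : compact C.
  apply: compact_closedI; first exact: compact_setX.
  rewrite -openC openE => -[x y] /= /negP; rewrite -ltNge => xy.
  have gap : 0 < (eta - mdist x y) / 2 by lra.
  apply/nbhs_ballP; exists ((eta - mdist x y) / 2) => //.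
  move=> [x' y'] [/=]; rewrite !ballEmdist/= => xx' yy'.
  apply/negP; rewrite -ltNge.
  have := metric_triangle x' x y'; have := metric_triangle x y y'.
  by rewrite (metric_sym x' x); lra.
pose Q (S : set (E * E)) := forall e', 0 < e' -> \forall n \near \oo,
  outer_le P [set w | G n w /\ S (X n w : E, Y n w : E)] e'.
have QC : Q C.
  apply: (compact_ideal cC).
  - move=> e' e'0; apply: nearW => n; rewrite (_ : [set _ | _] = set0).
      exact/outer_le0/ltW.
    by apply/seteqP; split => // w [].
  - move=> A B AB QB e' /QB; apply: filterS => n; apply: outer_le_sub.
    by move=> w [Gw /AB].
  - move=> A B QA QB e' e'0; have e'2 : 0 < e' / 2 by rewrite divr_gt0.
    apply: filterS2 (QA _ e'2) (QB _ e'2) => n An Bn; rewrite (splitr e').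
    by apply: outer_le_sub (outer_leU An Bn) => w [Gw [|]]; [left|right].
  move=> [x0 y0] [[/= Kx0 Ky0] x0y0].
  have [le0|nle0] := pselect (x0 <= y0)%O; last first.
    have [s s0 sP] := not_le_ball hle nle0.
    have s20 : 0 < s / 2 by rewrite divr_gt0.
    exists (ball (x0, y0) (s / 2)); first exact: nbhsx_ballx.
    move=> e' e'0; apply: filterS (r_lt _ s20) => n rs.
    apply: (@outer_le_sub _ _ _ _ _ set0); last exact/outer_le0/ltW.
    move=> w [Gw [[/=]]]; rewrite !ballEmdist/= => x0X y0Y _.
    have [y' [Yy' Xy' _]] := GP n w Gw.
    apply: (sP (X n w) y') => //; first by lra.
    by have := metric_triangle y0 (Y n w) y'; lra.
  have [s s0 sP] : exists2 s : R, 0 < s & forall y x,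
      mdist y0 y < s -> mdist x0 x < s -> ~ (y <= x)%O.
    apply: not_le_ball => // le1; move: x0y0.
    by rewrite (le_anti (introT andP (conj le0 le1))) mdistxx leNgt eta0.
  have s20 : 0 < s / 2 by rewrite divr_gt0.
  pose B := K `&` [set y | mdist y0 y <= s / 2].
  have cB : compact B.
    apply: compact_closedI => //.
    rewrite (_ : [set _ | _] = infdist [set y0] @^-1` [set t | t <= s / 2]); last first.
      by apply/seteqP; split => y /=; rewrite /infdist image_set1 inf1 metric_sym.
    apply: preimage_closed; last exact: closed_le.
    by move=> y _; apply: infdist_continuous; exists y0.
  pose U := upclosure B.
  have cU : closed U by exact: upclosure_closed.
  have uU : upset U by exact: upclosure_upset.
  have U0 : U !=set0.
    by exists y0; apply: subset_upclosure; split => //=; rewrite mdistxx ltW.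
  have i0 : 0 < infdist U x0.
    rewrite lt_neqAle infdist_ge0 andbT; apply/eqP => /esym /(closed_infdist0 cU U0).
    move=> [b [_ /= y0b] bx0]; apply: (sP b x0) => //; first lra.
    by rewrite mdistxx.
  have i20 : 0 < infdist U x0 / 2 by rewrite divr_gt0.
  exists (ball x0 (infdist U x0 / 2) `*` ball y0 (s / 2)).
    by exists (ball x0 (infdist U x0 / 2), ball y0 (s / 2)) => //; split;
      exact: nbhsx_ballx.
  move=> e' e'0; have e'3 : 0 < e' / 3 by rewrite divr_gt0.
  have [dl dl0 cross] := upset_crossing_near cU uU U0 i20 e'3.
  have [LY cLY LYP] := law_cvg_tight mY Ymu hE e'3.
  have [LZ cLZ LZP] := law_cvg_tight mZ Zmu hE e'3.
  have cL : compact (LY `|` LZ) by exact: compactU.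
  have [k k0 kP] := order_compact_modulus hle cL cU uU U0 dl0.
  apply: filterS2 cross (r_lt _ k0) => n crossn rk.
  have -> : e' = e' / 3 + e' / 3 + e' / 3 by lra.
  have := outer_leU (outer_leU crossn
    (measurable_outer_le (preim _ _ n mY cLY) (LYP n)))
    (measurable_outer_le (preim _ _ n mZ cLZ) (LZP n)).
  apply: outer_le_sub => w [Gw [[/= x0X y0Y] [[_ /= KYw] _]]].
  rewrite !ballEmdist/= in x0X y0Y.
  have [LYw|LYw] := pselect (LY (Y n w)); last by left; right.
  have [LZw|LZw] := pselect (LZ (Z n w)); last by right.
  left; left; split => /=.
    have [y' [Yy' Xy' y'Z]] := GP n w Gw.
    apply: (kP (Y n w) y') => //; [by left|by right|exact: le_lt_trans rk|].
    rewrite infdist_in//; apply: subset_upclosure; split => //=.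
    exact: ltW.
  by have := infdist_lip x0 (X n w) U0; lra.
apply: filterS (QC _ e40) => n QCn.
have -> : e = e / 3 + e / 3 + e / 3 by lra.
have := outer_leU (outer_leU QCn
    (measurable_outer_le (preim _ _ n mX cKX) (KXP n)))
    (measurable_outer_le (preim _ _ n mY cKY) (KYP n)).
apply: outer_le_sub => w [Gw /= XYw].
have [KXw|KXw] := pselect (KX (X n w)); last by left; right.
have [KYw|KYw] := pselect (KY (Y n w)); last by right.
by left; left; split => //; split => //; split; [left|right].
Qed.

End order_limits.

(** * Measurability and local uniform continuity of the flow *)

(** Weak convergence is used along sequences, whereas the flow is indexed by real
times. *)
Lemma eventually_of_sequences (R : realType) (Q : R -> Prop) :
  (forall s : nat -> R, (forall n, n%:R <= s n) -> \forall n \near \oo, Q (s n)) ->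
  exists2 s0 : R, 0 <= s0 & forall s, s0 <= s -> Q s.
Proof.
move=> Qseq; apply: contrapT => nQ.
have /choice[s sP] : forall n : nat, exists s : R, n%:R <= s /\ ~ Q s.
  move=> n; apply: contrapT => all_s; apply: nQ; exists n%:R => // s ns.
  by apply: contrapT => nQs; apply: all_s; exists s.
have [N _ /(_ N (leqnn N))] := Qseq s (fun n => (sP n).1).
exact: (sP N).2.
Qed.

Section measurable_flow.
Context (R : realType) (d : measure_display) (Omega : measurableType d)
  (P : probability Omega R) (E : pmetricType R)
  (theta : R -> Omega -> Omega) (phi : R -> Omega -> E -> E).
Hypotheses (htheta : metric_dynamical_system P theta)
  (hphi : random_dynamical_system theta phi).

Lemma measurable_theta t : measurable_fun setT (theta t).
Proof.
have := mds_measurable htheta => /measurableT_comp/(_ (pair1_measurable t)).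
by [].
Qed.

Lemma measurable_phi t d' (W : measurableType d') (g : W -> Omega) (a : W -> borel E) :
  0 <= t -> measurable_fun setT g -> measurable_fun setT a ->
  measurable_fun setT (fun w => phi t (g w) (a w) : borel E).
Proof.
move=> t0 mg ma.
apply: (@measurable_comp _ _ _ _ _ _ [set p : R * (Omega * borel E) | 0 <= p.1] _ _
   (fun w => (t, (g w, a w))) _ _ (rds_measurable hphi)).
- exact: (@measurable_set_ge _ _ _ fst 0).
- by move=> _ [w _ <-].
- by apply: measurable_fun_pair; [exact: measurable_cst|exact: measurable_fun_pair].
Qed.

Lemma measurable_phi_theta t s x : 0 <= t ->
  measurable_fun setT (fun w => phi t (theta s w) x : borel E).
Proof.
by move=> t0; apply: measurable_phi => //; exact: measurable_theta.
Qed.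

Lemma outer_le_theta s S e : outer_le P S e -> outer_le P (theta s @^-1` S) e.
Proof.
move=> [M [mM SM Me]]; exists (theta s @^-1` M); split.
- by rewrite -[X in measurable X]setTI; exact: measurable_theta.
- by move=> w /SM.
- by rewrite (mds_invariant htheta).
Qed.

(** The measure P is the image of itself under theta. *)
Lemma integral_theta s (u : Omega -> R) : measurable_fun setT u ->
  (forall w, 0 <= u w) ->
  (\int[P]_w (u (theta s w))%:E)%E = (\int[P]_w (u w)%:E)%E.
Proof.
move=> mu u0; have mth := measurable_theta s.
pose th : {mfun Omega >-> Omega} := mfun_Sub (mem_set mth).
have := @ge0_integral_pushforward _ _ _ _ _ _ mth P setT (EFin \o u) measurableT.
rewrite preimage_setT => <-; last 2 first.
- exact/measurable_EFinP.
- by move=> w _; rewrite lee_fin.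
apply: (@eq_measure_integral _ _ _ _ P (pushforward P th)) => A mA _.
by rewrite /pushforward; exact: (mds_invariant htheta).
Qed.

Variable mu : probability (borel E) R.
Hypothesis hmix : strongly_mixing P phi mu.

Lemma mixing_law_cvg (t s : nat -> R) x : (forall n, n%:R <= t n) ->
  law_cvg P (fun n w => phi (t n) (theta (s n) w) x : borel E) mu.
Proof.
move=> tn u cu u01.
have t0 n : 0 <= t n by apply: le_trans (tn n).
have t_oo : t n @[n --> \oo] --> +oo.
  apply/cvgryPge => A; near=> n; apply: le_trans (tn n).
  by near: n; exact: nbhs_infty_ger.
have := hmix x cu; move=> /(_ _)/wrap[].
  exists 1; split => // y y1 w _ /=; rewrite ger0_norm; last by case/andP: (u01 w).
  by apply: le_trans (ltW y1); case/andP: (u01 w).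
move=> /(cvg_comp _ _ t_oo); apply: cvg_trans; apply: near_eq_cvg.
apply: nearW => n /=.
have mu_ : measurable_fun [set: borel E] (u : borel E -> R).
  exact: continuous_borel_measurable.
have mphi : measurable_fun setT (fun w => phi (t n) w x : borel E).
  exact: measurable_phi.
rewrite (ge0_integral_pushforward mphi)//; last 2 first.
- exact/measurable_EFinP.
- by move=> y _; rewrite lee_fin; case/andP: (u01 y).
rewrite preimage_setT (@integral_theta (s n) (fun w => u (phi (t n) w x)))//.
- exact: (measurableT_comp mu_ mphi).
- by move=> w; case/andP: (u01 (phi (t n) w x)).
Unshelve. all: by end_near. Qed.

(** For fixed w, continuity gives a modulus that is uniform near K by
compactness. The exceptional events decrease to the empty set as the modulus shrinks;
restricting x and y to a dense sequence makes them measurable. *)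
Lemma phi_uniformly_continuous (c : nat -> E) (K : set E) t r e :
  dense (range c) -> compact K -> K !=set0 -> 0 <= t -> 0 < r -> 0 < e ->
  exists2 dl : R, 0 < dl &
    outer_le P [set w | exists x y, [/\ K y, mdist x y < dl &
      r < mdist (phi t w x) (phi t w y)]] e.
Proof.
move=> dc cK K0 t0 r0 e0.
have cphi w : continuous (phi t w) by exact: (rds_continuous hphi).
pose dlt n : R := n.+1%:R^-1.
have dlt0 n : 0 < dlt n by rewrite invr_gt0.
pose B n := \bigcup_i \bigcup_j [set w | [/\ infdist K (c i) < dlt n,
  mdist (c i) (c j) < dlt n & r < mdist (phi t w (c i)) (phi t w (c j))]].
have mB n : measurable (B n).
  apply: bigcupT_measurable => i; apply: bigcupT_measurable => j.
  have [cond|ncond] := pselect (infdist K (c i) < dlt n /\ mdist (c i) (c j) < dlt n).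
    rewrite (_ : [set _ | _] = [set w | r < mdist (phi t w (c i)) (phi t w (c j))]).
      apply: measurable_set_gt; apply: (mdist_measurable dc);
        exact: measurable_phi.
    by apply/seteqP; split => [w []//|w rw]; case: cond.
  rewrite (_ : [set _ | _] = set0)//.
  by apply/seteqP; split => // w [? ? _]; apply: ncond.
have niB : nonincreasing_seq B.
  move=> m n mn; apply/subsetPset => w [i _ [j _ [ci cij rw]]].
  have mn' : dlt n <= dlt m by rewrite lef_pV2 ?posrE// ler_nat ltnS.
  by exists i => //; exists j => //; split => //; exact: lt_le_trans mn'.
have capB : \bigcap_n B n = set0.
  apply/seteqP; split => // w Bw.
  have [|k k0 kP] := @compact_uniform_radius R E K
    (fun k y => forall x1 x2, mdist y x1 < k -> mdist x1 x2 < k ->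
       mdist (phi t w x1) (phi t w x2) <= r) cK.
    move=> p Kp.
    have r20 : 0 < r / 2 by rewrite divr_gt0.
    have := cphi w p => /metricType_numDomainType.cvgrPdist_lt/(_ _ r20).
    move=> /metricType_numDomainType.nbhs_mdistP[q /= q0 qP].
    exists (q / 3); first by rewrite divr_gt0.
    move=> p' k; rewrite ballEmdist/= => pp' /andP[k0 kq] x1 x2 px1 x12.
    have tr1 := metric_triangle p p' x1; have tr2 := metric_triangle p x1 x2.
    have q1 : mdist (phi t w p) (phi t w x1) < r / 2 by apply: qP => /=; lra.
    have q2 : mdist (phi t w p) (phi t w x2) < r / 2 by apply: qP => /=; lra.
    have := metric_triangle (phi t w x1) (phi t w p) (phi t w x2).
    by rewrite (metric_sym (phi t w x1) (phi t w p)); lra.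
  have [n _ /(_ n (leqnn n))/= nk] := near_infty_natSinv_lt (PosNum k0).
  have [i _ [j _ [ci cij rw]]] := Bw n I.
  have [y Ky ciy] := infdist_lt K0 ci.
  have : mdist (phi t w (c i)) (phi t w (c j)) <= r.
    apply: (kP y Ky); last exact: lt_trans cij nk.
    by rewrite metric_sym; exact: lt_trans ciy nk.
  by rewrite leNgt rw.
have := nonincreasing_prob_near P mB niB e0.
rewrite capB measure0 => [[n _ /(_ n (leqnn n))/=]]; rewrite add0e => Be.
exists (dlt n) => //; exists (B n); split => // w [x [y [Ky xy rxy]]].
have dense_near (a : E) (A : set E) : nbhs a A -> exists i, A (c i).
  rewrite nbhsE => -[V [oV Va] VA].
  have [|b [Vb [i _ ib]]] := dc V _ oV; first by exists a.
  by exists i; apply: VA; rewrite ib.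
have gap : 0 < Num.min ((mdist (phi t w x) (phi t w y) - r) / 2)
    ((dlt n - mdist x y) / 2).
  by rewrite lt_min; apply/andP; split; lra.
set q := Num.min _ _ in gap.
have q1 : q <= (mdist (phi t w x) (phi t w y) - r) / 2 by rewrite ge_min lexx.
have q2 : q <= (dlt n - mdist x y) / 2 by rewrite ge_min lexx orbT.
have near_pt (a : E) : exists i, mdist a (c i) < q /\
    mdist (phi t w a) (phi t w (c i)) < q.
  apply: (dense_near a (fun b => mdist a b < q /\
    mdist (phi t w a) (phi t w b) < q)).
  apply: filterI.
    by apply/metricType_numDomainType.nbhs_mdistP; exists q.
  by have /metricType_numDomainType.cvgrPdist_lt/(_ _ gap) := cphi w a.
have [i [yi yi']] := near_pt y.
have [j [xj xj']] := near_pt x.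
exists i => //; exists j => //; split.
- apply: le_lt_trans (infdist_le _ Ky) _; rewrite metric_sym.
  have := mdist_ge0 x y; have := dlt0 n; lra.
- have := metric_triangle (c i) y (c j); have := metric_triangle y x (c j).
  rewrite (metric_sym (c i) y) (metric_sym y x); lra.
- have := metric_triangle (phi t w x) (phi t w (c j)) (phi t w y).
  have := metric_triangle (phi t w (c j)) (phi t w (c i)) (phi t w y).
  rewrite (metric_sym (phi t w (c i)) (phi t w y)).
  rewrite (metric_sym (phi t w (c i)) (phi t w (c j))); lra.
Qed.

End measurable_flow.

(** * The pullback flow is Cauchy in probability *)

Lemma polish_tight (R : realType) (E : pmetricType R) (mu : probability (borel E) R)
  (e : R) : polish R E -> 0 < e ->
  exists2 K : set E, compact K & (mu (~` K : set (borel E)) <= e%:E)%E.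
Proof.
move=> hE e0.
have [||K cK KP] := @law_cvg_tight R _ _ mu E (fun _ y => y) mu _ _ e hE e0.
- by move=> _; exact: measurable_id.
- by move=> u _ _; exact: cvg_cst.
- by exists K => //; exact: (KP 0%N).
Qed.

Definition pullback (R : realType) (Omega E : Type) (theta : R -> Omega -> Omega)
    (phi : R -> Omega -> E -> E) (t : R) (x : E) (w : Omega) : E :=
  phi t (theta (- t) w) x.

Section synchronization.
Context (R : realType) (d : measure_display) (Omega : measurableType d)
  (P : probability Omega R) (disp : Order.disp_t) (E : porderPMetricType disp R)
  (theta : R -> Omega -> Omega) (phi : R -> Omega -> E -> E)
  (mu : probability (borel E) R).
Hypotheses (hE : polish R E) (hle : closed_order E)
  (htheta : metric_dynamical_system P theta)
  (hphi : random_dynamical_system theta phi)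
  (hmono : order_preserving phi)
  (hmix : strongly_mixing P phi mu).

Lemma itv_closed (f g : E) : closed (`[f, g]%classic : set E).
Proof.
have -> : (`[f, g]%classic : set E) =
    (fun x => (f, x)) @^-1` [set p : E * E | (p.1 <= p.2)%O] `&`
    (fun x => (x, g)) @^-1` [set p : E * E | (p.1 <= p.2)%O].
  by apply/seteqP; split => x /=; rewrite in_itv/= => /andP.
by apply: closedI; apply: preimage_closed => // x _;
  apply: cvg_pair => //=; exact: cvg_cst.
Qed.

Section one_interval.
Variables (f g : E) (e : R).
Hypotheses (fg : (f <= g)%O) (e0 : 0 < e) (e_small : e < 1 / 2)
  (mu_fg : ((1 - e)%:E <= mu `[f, g]%classic)%E).

(** At time s the flow from z is close to some y in a compact part of [f, g]; moving on
by time t keeps it close to the image of y, which lies between the images of f and g. *)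
Lemma eventually_near_interval z (t r : R) : 0 <= t -> 0 < r ->
  exists2 s0 : R, 0 <= s0 & forall s, s0 <= s ->
    outer_le P (~` [set w | exists y' : E, [/\ mdist (phi (t + s) w z) y' <= r,
       (phi t (theta s w) f <= y')%O & (y' <= phi t (theta s w) g)%O]]) (4 * e).
Proof.
move=> t0 r0.
have [c dc] := polish_dense_seq hE.
have [K0 cK0 K0P] := polish_tight mu hE e0.
pose K : set E := K0 `&` `[f, g]%classic.
have mI : measurable (`[f, g]%classic : set (borel E)).
  by apply: closed_borel; exact: itv_closed.
have mK0 : measurable (K0 : set (borel E)).
  exact: compact_borel.
have cK : compact K by apply: compact_closedI => //; exact: itv_closed.
have mK : measurable (K : set (borel E)) by exact: measurableI.
have KP : (mu (~` K : set (borel E)) <= (2 * e)%:E)%E.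
  have -> : 2 * e = e + e by lra.
  rewrite /K setCI EFinD.
  apply: (le_trans (measureU2 _ (measurableC mK0) (measurableC mI))).
  have nI : (mu (~` `[f, g]%classic : set (borel E)) <= e%:E)%E.
    have /fineK fin := fin_num_measure mu _ mI.
    rewrite (probability_setC mu mI); move: mu_fg; rewrite -fin -EFinB !lee_fin.
    by lra.
  exact: leeD.
have Kn0 : K !=set0.
  apply/set0P/eqP => K_0; move: KP; rewrite K_0 setC0 probability_setT lee_fin.
  by move=> ?; move: e_small; lra.
have [dl dl0 dlP] := phi_uniformly_continuous P hphi dc cK Kn0 t0 r0 e0.
have [|s0 s00 s0P] := @eventually_of_sequences R (fun s =>
    (P [set w | (dl <= infdist K (phi s w z))%R] <= (3 * e)%:E)%E).
  move=> s sn.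
  have sn0 n : 0 <= s n by apply: le_trans (sn n).
  have lawz : law_cvg P (fun n w => phi (s n) w z : borel E) mu.
    have := mixing_law_cvg htheta hphi hmix (fun=> 0) z sn.
    by under eq_fun do under eq_fun do rewrite (mds_zero htheta).
  have := @portmanteau _ _ _ P E _ mu (infdist K) 0 dl e _ lawz
    (infdist_continuous Kn0) dl0 e0.
  move=> /(_ _)/wrap[].
    by move=> n; apply: (measurable_phi hphi).
  apply: filterS => n /le_trans; apply.
  have -> : 3 * e = 2 * e + e by lra.
  rewrite EFinD leeD2r//; apply: le_trans KP; apply: le_measure; rewrite ?inE.
  - apply: measurable_set_gt; apply: continuous_borel_measurable.
    exact: infdist_continuous.
  - exact: measurableC.
  - by move=> y /= /[swap] /infdist_in ->; rewrite ltxx.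
exists s0 => // s ss0.
have ss : 0 <= s by exact: le_trans ss0.
have mh : measurable_fun [set: borel E] (infdist K : borel E -> R).
  by apply: continuous_borel_measurable; exact: infdist_continuous.
have mA : measurable [set w | dl <= infdist K (phi s w z)].
  apply: measurable_set_ge.
  have mz : measurable_fun setT (fun w => phi s w z : borel E).
    exact: (measurable_phi hphi).
  exact: (measurableT_comp mh mz).
have -> : 4 * e = e + 3 * e by lra.
have := outer_leU (outer_le_theta htheta s dlP) (measurable_outer_le mA (s0P s ss0)).
apply: outer_le_sub => w /= nG.
have [far|near_K] := leP dl (infdist K (phi s w z)); [by right|left].
have [y Ky zy] := infdist_lt Kn0 near_K.
exists (phi s w z), y; split => //; rewrite ltNge; apply/negP => le_r.
have [_ ] := Ky; rewrite /= in_itv/= => /andP[fy yg].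
apply: nG; exists (phi t (theta s w) y); split.
- by rewrite (rds_cocycle hphi).
- exact: hmono.
- exact: hmono.
Qed.

(** Otherwise there would be times t n and s n with n <= t n for which the bound
fails, and [order_squeeze] applies to the resulting sequences: the images of f and g and
the flow from z all have laws converging to mu. *)
Lemma eventually_close_to_endpoint z (eta : R) : 0 < eta ->
  exists2 T : R, 0 <= T & forall t, T <= t ->
  exists2 s0 : R, 0 <= s0 & forall s, s0 <= s ->
    outer_le P [set w | eta <= mdist (phi t (theta s w) f) (phi (t + s) w z)] (5 * e).
Proof.
move=> eta0; apply: eventually_of_sequences => t tn.
have t0 n : 0 <= t n by apply: le_trans (tn n).
pose r n : R := n.+1%:R^-1.
have r0 n : 0 < r n by rewrite invr_gt0.
have /choice[s1 s1P] : forall n, exists s1 : R, 0 <= s1 /\ forall s, s1 <= s ->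
    outer_le P (~` [set w | exists y' : E, [/\ mdist (phi (t n + s) w z) y' <= r n,
       (phi (t n) (theta s w) f <= y')%O & (y' <= phi (t n) (theta s w) g)%O]]) (4 * e).
  by move=> n; have [s1 s10 s1P] := eventually_near_interval z (t0 n) (r0 n); exists s1.
pose good n s := outer_le P
  [set w | eta <= mdist (phi (t n) (theta s w) f) (phi (t n + s) w z)] (5 * e).
(* Choose a failing time s n after s1 n whenever there is one. *)
have /choice[s sP] : forall n, exists s, s1 n <= s /\
    (good n s -> forall s', s1 n <= s' -> good n s').
  move=> n; have [[s [s1s ns]]|no] := pselect (exists s, s1 n <= s /\ ~ good n s).
    by exists s.
  exists (s1 n); split => // _ s' s1s'; apply: contrapT => ng.
  by apply: no; exists s'.
have s_ge0 n : 0 <= s n by exact: le_trans (s1P n).1 (sP n).1.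
have ts0 n : 0 <= t n + s n by rewrite addr_ge0.
have law (x : E) := mixing_law_cvg htheta hphi hmix s x tn.
have mflow (x : E) n : measurable_fun setT (fun w => phi (t n) (theta (s n) w) x : borel E).
  exact: (measurable_phi_theta htheta hphi).
have lawY : law_cvg P (fun n w => phi (t n + s n) w z : borel E) mu.
  have := mixing_law_cvg htheta hphi hmix (fun=> 0) z
    (fun n => le_trans (tn n) (ltac:(by rewrite lerDl) : t n <= t n + s n)).
  by under eq_fun do under eq_fun do rewrite (mds_zero htheta).
have := @order_squeeze R disp E hE hle _ _ P mu _ _ (mflow f) (mflow g) (law f) (law g) _
  (fun n w => phi (t n + s n) w z : borel E)
  (fun n => [set w | exists y' : E, [/\ mdist (phi (t n + s n) w z) y' <= r n,
     (phi (t n) (theta (s n) w) f <= y')%O &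
     (y' <= phi (t n) (theta (s n) w) g)%O]]) r eta e.
move=> /(_ _ _ lawY _ _ eta0 e0)/wrap[].
- by move=> n w; exact: hmono.
- by move=> n; apply: (measurable_phi hphi).
- exact: cvg_harmonic.
- by move=> n w.
apply: filterS => n close_n.
exists (s1 n); first exact: (s1P n).1.
apply: (sP n).2; rewrite /good.
have -> : 5 * e = e + 4 * e by lra.
have := outer_leU close_n ((s1P n).2 _ (sP n).1).
apply: outer_le_sub => w eta_w.
have [Gw|nGw] := pselect (exists y' : E, [/\ mdist (phi (t n + s n) w z) y' <= r n,
     (phi (t n) (theta (s n) w) f <= y')%O &
     (y' <= phi (t n) (theta (s n) w) g)%O]); [by left|by right].
Qed.

End one_interval.

Local Notation psi := (pullback theta phi).

Hypothesis hmu : forall eps : R, 0 < eps ->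
   exists f g : E, (f <= g)%O /\ ((1 - eps)%:E <= mu `[f, g]%classic)%E.

(** Both pullback flows are compared with psi_t^f for the same f and t. The choice
of f depends on e, since only a portion 1 - e of the mass lies in [f, g]. *)
Lemma pullback_cauchy (z z' : E) (eta e : R) : 0 < eta -> 0 < e ->
  exists2 T : R, 0 <= T & forall u u', T <= u -> T <= u' ->
    outer_le P [set w | eta <= mdist (psi u z w) (psi u' z' w)] e.
Proof.
(* each of the two comparisons costs 5 e'; an interval of mass 1 - e' needs e' < 1 / 2
   to meet the compact set *)
move=> eta0 e0; pose e' := Num.min (e / 10) (1 / 4).
have e'0 : 0 < e' by rewrite lt_min divr_gt0//=; lra.
have e'e : e' <= e / 10 by rewrite ge_min lexx.
have e'4 : e' < 1 / 2.
  by apply: (@le_lt_trans _ _ (1 / 4)); [rewrite ge_min lexx orbT|lra].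
have [f [g [fg mu_fg]]] := hmu e'0.
have eta20 : 0 < eta / 2 by rewrite divr_gt0.
have [T T0 TP] := eventually_close_to_endpoint fg e'0 e'4 mu_fg z eta20.
have [T' T'0 T'P] := eventually_close_to_endpoint fg e'0 e'4 mu_fg z' eta20.
pose t := Num.max T T'.
have [s s0 sP] := TP t ltac:(by rewrite le_max lexx).
have [s' s'0 s'P] := T'P t ltac:(by rewrite le_max lexx orbT).
have t0 : 0 <= t by rewrite le_max T0.
have shift x q v : (forall r, q <= r -> outer_le P
     [set w | eta / 2 <= mdist (phi t (theta r w) f) (phi (t + r) w x)] (5 * e')) ->
   t + q <= v -> outer_le P
     [set w | eta / 2 <= mdist (psi t f w) (psi v x w)] (5 * e').
  move=> qP tqv; have := outer_le_theta htheta (- v) (qP (v - t) ltac:(lra)).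
  apply: outer_le_sub => w /=.
  rewrite -(mds_add htheta) (_ : v - t - v = - t); last by lra.
  by rewrite (_ : t + (v - t) = v); last by lra.
exists (t + Num.max s s'); first by rewrite addr_ge0// le_max s0.
move=> u u' tu tu'.
have su : s <= Num.max s s' by rewrite le_max lexx.
have su' : s' <= Num.max s s' by rewrite le_max lexx orbT.
have tsu : t + s <= u by apply: le_trans tu; rewrite lerD2l.
have tsu' : t + s' <= u' by apply: le_trans tu'; rewrite lerD2l.
have := outer_leU (shift z s u sP tsu) (shift z' s' u' s'P tsu').
have le_e : 5 * e' + 5 * e' <= e by lra.
move=> /(outer_leW le_e); apply: outer_le_sub => w /= le_eta.
have [|h1] := leP (eta / 2) (mdist (psi t f w) (psi u z w)); first by left.
have [|h2] := leP (eta / 2) (mdist (psi t f w) (psi u' z' w)); first by right.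
have := metric_triangle (psi u z w) (psi t f w) (psi u' z' w).
by rewrite (metric_sym (psi u z w) (psi t f w)); lra.
Qed.

End synchronization.

(** * Almost sure limits *)

Section fast_cauchy.
Context (R : realType) (E : metricType R).

Lemma fast_cauchy_dist (u : nat -> E) N :
  (forall k, (N <= k)%N -> mdist (u k) (u k.+1) < 2^-1 ^+ k) ->
  forall j m, (N <= j)%N -> mdist (u j) (u (j + m)%N) <= 2 * 2^-1 ^+ j.
Proof.
move=> uN j m Nj.
have pow0 k : 0 < 2^-1 ^+ k :> R by rewrite exprn_gt0// invr_gt0.
suff : mdist (u j) (u (j + m)%N) <= 2 * 2^-1 ^+ j - 2 * 2^-1 ^+ (j + m).
  by have := pow0 (j + m)%N; lra.
elim: m => [|m IH]; first by rewrite addn0 mdistxx subrr.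
have := metric_triangle (u j) (u (j + m)%N) (u (j + m).+1).
have := uN (j + m)%N (leq_trans Nj (leq_addr _ _)).
rewrite addnS exprS; move: IH.
set p := _ ^+ (j + m); set q := _ ^+ j.
by rewrite mulrA divff// mul1r; lra.
Qed.

(** A Cauchy sequence with a cluster point converges, and a compact set that is visited
infinitely often provides the cluster point. This replaces completeness of the metric. *)
Lemma fast_cauchy_cvg (u : nat -> E) (K : set E) N : compact K ->
  (forall k, (N <= k)%N -> mdist (u k) (u k.+1) < 2^-1 ^+ k) ->
  (forall n, exists2 k, (n <= k)%N & K (u k)) ->
  exists l : E, u n @[n --> \oo] --> l.
Proof.
move=> cK uN uK.
pose F := [set A : set E | exists n, forall k, (n <= k)%N -> K (u k) -> A (u k)].
have FF : Filter F.
  split => [|A B [n An] [m Bm]|A B AB [n An]].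
  - by exists 0%N.
  - exists (maxn n m) => k; rewrite geq_max => /andP[nk mk] Kk.
    by split; [exact: An|exact: Bm].
  - by exists n => k nk /(An k nk)/AB.
have PF : ProperFilter F.
  apply: Build_ProperFilter => -[n nF].
  by have [k nk Kk] := uK n; exact: (nF k nk Kk).
have FK : F K by exists 0%N.
have [p [_ clp]] := cK F PF FK.
exists p; apply/metricType_numDomainType.cvgrPdist_lt => eps eps0.
have pow_small : \forall n \near \oo, 2 * 2^-1 ^+ n < eps / 2.
  have := @cvg_geometric R 2 (2^-1).
  rewrite ger0_norm ?invr_ge0// => /(_ ltac:(lra)) /cvgrPdist_lt/(_ (eps / 2)).
  rewrite divr_gt0// => /(_ isT); apply: filterS => n.
  by rewrite sub0r normrN; exact: le_lt_trans (ler_norm _).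
have [M _ MP] := pow_small.
have FM : F [set u k | k in [set k | (maxn M N <= k)%N]].
  by exists (maxn M N) => k Mk _; exists k.
have e20 : 0 < eps / 2 by rewrite divr_gt0.
have [_ [[k /= Mk <-]]] := clp _ _ FM (nbhsx_ballx p _ e20).
move: Mk; rewrite geq_max => /andP[Mk Nk]; rewrite ballEmdist/= => pk.
exists k => // j /= kj.
have := fast_cauchy_dist uN (j - k) Nk; rewrite subnKC// => d1.
have := metric_triangle p (u k) (u j); have := MP k Mk => /=.
by lra.
Qed.

End fast_cauchy.

Section measurable_limits.
Context (R : realType) (E : pmetricType R).

(** An open set V is detected by the distance to its complement, and this distance
is a limit of measurable real functions. *)
Lemma measurable_fun_metric_cvg d (W : measurableType d)
    (f : nat -> W -> borel E) (a : W -> borel E) :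
  (forall n, measurable_fun setT (f n)) ->
  (forall w, (f n w : E) @[n --> \oo] --> (a w : E)) ->
  measurable_fun setT a.
Proof.
move=> mf fa.
apply: (@measurability _ _ W (borel E) setT a (@open E)) => //.
move=> _ [V oV <-]; rewrite setTI.
have [V0|V0] := eqVneq (~` V) set0; last first.
  have {}V0 : (~` V) !=set0 by exact/set0P.
  rewrite (_ : _ @^-1` _ = [set w | 0 < infdist (~` V) (a w : E)]).
    apply: measurable_set_gt.
    apply: (@measurable_fun_cvg _ _ _ _ (fun n w => infdist (~` V) (f n w : E))).
      move=> n; have mh : measurable_fun [set: borel E] (infdist (~` V) : borel E -> R).
        by apply: continuous_borel_measurable; exact: infdist_continuous.
      exact: (measurableT_comp mh (mf n)).
    move=> w _; have := @infdist_continuous R E _ V0 (a w).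
    by move=> /(cvg_comp _ _ (fa w)).
  apply/seteqP; split => w /=.
    move=> Va; rewrite lt_neqAle infdist_ge0 andbT; apply/eqP => /esym.
    by move=> /(closed_infdist0 (open_closedC oV) V0).
  by move=> a0; apply: contrapT => nV; move: a0; rewrite (@infdist_in _ _ (~` V))// ltxx.
by rewrite -(setCK V) V0 setC0 preimage_setT.
Qed.

Lemma as_cvg_in_prob (c : nat -> E) d (W : measurableType d) (P : probability W R)
    (f : nat -> W -> borel E) (a : W -> borel E) (W0 : set W) (eta e : R) :
  dense (range c) ->
  (forall n, measurable_fun setT (f n)) -> measurable_fun setT a ->
  measurable W0 -> P (~` W0) = 0%E ->
  (forall w, W0 w -> (f n w : E) @[n --> \oo] --> (a w : E)) ->
  0 < eta -> 0 < e ->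
  \forall n \near \oo, outer_le P [set w | eta <= mdist (f n w : E) (a w)] e.
Proof.
move=> dc mf ma mW0 PW0 fa eta0 e0.
pose A n := [set w | eta <= mdist (f n w : E) (a w)].
have mA n : measurable (A n).
  by apply: measurable_set_ge; exact: (mdist_measurable dc).
pose B n := \bigcup_(k in [set k | (n <= k)%N]) A k.
have mB n : measurable (B n) by apply: bigcup_measurable => k _.
have niB : nonincreasing_seq B.
  move=> m n mn; apply/subsetPset => w [k /= nk Ak].
  by exists k => //=; exact: leq_trans nk.
have PB : P (\bigcap_n B n) = 0%E.
  apply/eqP; rewrite eq_le measure_ge0 andbT -PW0.
  apply: le_measure; rewrite ?inE; [exact: bigcapT_measurable|exact: measurableC|].
  move=> w Bw /fa /metricType_numDomainType.cvgrPdist_lt/(_ _ eta0)[n _ nP].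
  have [k nk] := Bw n I; rewrite /A/= leNgt metric_sym => /negP; apply.
  exact: nP.
have := nonincreasing_prob_near P mB niB e0; rewrite PB.
apply: filterS => n; rewrite add0e => Bn.
by exists (B n); split => // w Aw; exists n => /=.
Qed.

End measurable_limits.

(** * Construction of the random point *)

Section past_measurability.
Context (R : realType) (d : measure_display) (Omega : measurableType d)
  (P : probability Omega R) (E : pmetricType R)
  (theta : R -> Omega -> Omega) (phi : R -> Omega -> E -> E).
Hypotheses (htheta : metric_dynamical_system P theta)
  (hphi : random_dynamical_system theta phi).

Lemma past_sub_measurable (A : set Omega) :
  measurable (A : set (past theta phi)) -> measurable A.
Proof.
move: A; apply: smallest_sub; first exact: sigma_algebra_measurable.
move=> A [s /= s0]; move: A.
apply: smallest_sub; first exact: sigma_algebra_measurable.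
move=> A [h [x [B [/andP[h0 _] mB ->]]]].
rewrite -[X in measurable X]setTI.
exact: (measurable_phi_theta htheta hphi s x h0).
Qed.

Lemma measurable_pullback_past t x : 0 <= t ->
  measurable_fun [set: past theta phi]
    (pullback theta phi t x : past theta phi -> borel E).
Proof.
move=> t0 _ B mB; rewrite setTI.
apply: sub_sigma_algebra; exists (- t) => /=; first by rewrite oppr_le0.
apply: sub_sigma_algebra; exists t, x, B; split => //.
by rewrite t0/= sub0r opprK.
Qed.

Lemma measurable_pullback t x : 0 <= t ->
  measurable_fun setT (pullback theta phi t x : Omega -> borel E).
Proof. by move=> t0; exact: (measurable_phi_theta htheta hphi). Qed.

End past_measurability.

Section attractor.
Context (R : realType) (d : measure_display) (Omega : measurableType d)
  (P : probability Omega R) (disp : Order.disp_t) (E : porderPMetricType disp R)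
  (theta : R -> Omega -> Omega) (phi : R -> Omega -> E -> E)
  (mu : probability (borel E) R).
Hypotheses (hE : polish R E) (hle : closed_order E)
  (htheta : metric_dynamical_system P theta)
  (hphi : random_dynamical_system theta phi)
  (hmono : order_preserving phi)
  (hmix : strongly_mixing P phi mu)
  (hmu : forall eps : R, 0 < eps ->
   exists f g : E, (f <= g)%O /\ ((1 - eps)%:E <= mu `[f, g]%classic)%E).

Local Notation psi := (pullback theta phi).

Lemma fast_cauchy_times (z : E) : exists t : nat -> R,
  (forall n, n%:R <= t n) /\
  (forall n, outer_le P [set w | 2^-1 ^+ n <= mdist (psi (t n) z w) (psi (t n.+1) z w)]
     (1 / (2 ^ n.+1)%:R)).
Proof.
have /choice[T TP] : forall n : nat, exists T : R, 0 <= T /\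
    forall u u', T <= u -> T <= u' ->
      outer_le P [set w | 2^-1 ^+ n <= mdist (psi u z w) (psi u' z w)]
        (1 / (2 ^ n.+1)%:R).
  move=> n; have eta0 : 0 < 2^-1 ^+ n :> R by rewrite exprn_gt0// invr_gt0.
  have e0 : 0 < 1 / (2 ^ n.+1)%:R :> R by rewrite divr_gt0// ltr0n expn_gt0.
  have [T T0 TP] := pullback_cauchy hE hle htheta hphi hmono hmix hmu z z eta0 e0.
  by exists T.
(* Partial sums turn the thresholds into a nondecreasing sequence of times. *)
pose S n := \sum_(i < n.+1) T i.
have S0 n : 0 <= S n by apply: sumr_ge0 => i _; exact: (TP i).1.
have TS n : T n <= S n.
  by rewrite /S big_ord_recr/= lerDr; apply: sumr_ge0 => i _; exact: (TP i).1.
have SS n : S n <= S n.+1.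
  by rewrite /S [leRHS]big_ord_recr/= lerDl; exact: (TP n.+1).1.
exists (fun n => n%:R + S n); split => [n|n]; first by rewrite lerDl.
apply: (TP n).2; first by apply: le_trans (TS n) _; rewrite lerDr.
by apply: le_trans (TS n) _; apply: le_trans (SS n) _; rewrite lerDr.
Qed.

(** The limit exists outside two null events: infinitely many large increments, and
escaping every compact set of an exhausting sequence. Both belong to the past, so that
setting the sequence to a constant there keeps the limit measurable for the past. *)
Lemma pullback_limit (z : E) : exists (a : Omega -> E) (t : nat -> R) (W0 : set Omega),
  [/\ measurable_fun [set: past theta phi] (a : past theta phi -> borel E),
      forall n, n%:R <= t n,
      measurable W0,
      P (~` W0) = 0%E &
      forall w, W0 w -> psi (t n) z w @[n --> \oo] --> a w].
Proof.
have [c dc] := polish_dense_seq hE.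
have [t [tn tP]] := fast_cauchy_times z.
have t0 n : 0 <= t n by apply: le_trans (tn n).
pose xi n := psi (t n) z.
pose pOmega : measurableType _ := past theta phi.
have mxi n : measurable_fun [set: pOmega] (xi n : pOmega -> borel E).
  exact: measurable_pullback_past.
have mxi' n : measurable_fun setT (xi n : Omega -> borel E).
  exact: (measurable_pullback htheta hphi).
have law_xi : law_cvg P (xi : nat -> Omega -> borel E) mu.
  exact: (mixing_law_cvg htheta hphi hmix (fun n => - t n) z tn).
pose em m : R := m.+1%:R^-1.
have em0 m : 0 < em m by rewrite invr_gt0.
have /choice[K KP] : forall m, exists K : set E, compact K /\
    forall n, (P (xi n @^-1` ~` K) <= (em m)%:E)%E.
  by move=> m; have [K cK KP] := law_cvg_tight mxi' law_xi hE (em0 m); exists K.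
have mK m : measurable (K m : set (borel E)).
  exact: compact_borel (KP m).1.
pose A n := [set w | 2^-1 ^+ n <= mdist (xi n w) (xi n.+1 w)].
have mA n : measurable (A n : set pOmega).
  by apply: measurable_set_ge; exact: (mdist_measurable dc (mxi n) (mxi n.+1)).
have mout m n : measurable ((xi n @^-1` (~` K m)) : set pOmega).
  by rewrite -[X in measurable X]setTI; apply: mxi => //; exact: measurableC.
pose escape m := \bigcup_N \bigcap_(n in [set n | (N <= n)%N]) (xi n @^-1` (~` K m)).
have mescape m : measurable (escape m : set pOmega).
  apply: bigcupT_measurable => N; apply: bigcap_measurable => //.
  by exists N => /=.
pose bad : set pOmega := lim_sup_set A `|` \bigcap_m escape m.
have mbad : measurable bad.
  apply: measurableU; last exact: bigcapT_measurable.
  apply: bigcapT_measurable => N; exact: bigcup_measurable.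
have toO (B : set Omega) : measurable (B : set pOmega) -> measurable B.
  exact: (past_sub_measurable htheta hphi).
have Pbad : P bad = 0%E.
  apply/eqP; rewrite -measure_le0.
  have P1 : P (lim_sup_set A) = 0%E.
    apply: lim_sup_set_cvg0; first by move=> n; exact: toO.
    apply: (@le_lt_trans _ _ 1%:E); last exact: ltry.
    apply: le_trans (epsilon_trick0 xpredT ler01).
    apply: lee_nneseries => // n _.
    by apply: outer_le_measurable; [exact: toO|exact: tP].
  have P2 : P (\bigcap_m escape m) = 0%E.
    apply/eqP; rewrite -measure_le0; apply/lee_addgt0Pr => e e0; rewrite add0e.
    have [m _ /(_ m (leqnn m))/= me] := near_infty_natSinv_lt (PosNum e0).
    apply: (@le_trans _ _ (em m)%:E); last by rewrite lee_fin ltW.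
    apply: (@le_trans _ _ (P (escape m))).
      apply: le_measure; rewrite ?inE; [by apply: toO; exact: bigcapT_measurable|exact: toO|].
      exact: bigcap_inf.
    have mN N : measurable (\bigcap_(n in [set n | (N <= n)%N]) (xi n @^-1` (~` K m))).
      by apply: toO; apply: bigcap_measurable => //; exists N => /=.
    have : P \o (fun N => \bigcap_(n in [set n | (N <= n)%N]) (xi n @^-1` (~` K m)))
        @ \oo --> P (escape m).
      apply: nondecreasing_cvg_mu => //; first exact: (toO _ (mescape m)).
      move=> N N' NN'; apply/subsetPset => w wN n /= N'n.
      by apply: wN => /=; exact: leq_trans N'n.
    move=> cvgN; rewrite -(cvg_lim _ cvgN)//; apply: lime_le.
      by apply/cvg_ex; eexists; exact: cvgN.
    apply: nearW => N /=; apply: le_trans ((KP m).2 N).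
    apply: le_measure; rewrite ?inE//; first exact: toO.
    by move=> w /(_ N) /=; apply.
  have m1 : measurable (lim_sup_set A : set Omega).
    by apply: toO; apply: bigcapT_measurable => N; exact: bigcup_measurable.
  have m2 : measurable (\bigcap_m escape m : set Omega).
    by apply: toO; exact: bigcapT_measurable.
  apply: (le_trans (measureU2 P m1 m2)).
  have P1' : (P (lim_sup_set A) <= 0)%E by rewrite P1.
  have P2' : (P (\bigcap_m escape m) <= 0)%E by rewrite P2.
  by have := leeD P1' P2'; rewrite adde0.
pose W0 : set pOmega := ~` bad.
have mW0 : measurable W0 by exact: measurableC.
have cvg_xi w : W0 w -> exists l : E, xi n w @[n --> \oo] --> l.
  move=> /not_orP[/= nA nesc].
  have [N NP] : exists N, forall k, (N <= k)%N ->
      mdist (xi k w) (xi k.+1 w) < 2^-1 ^+ k.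
    apply: contrapT => noN; apply: nA => N _; apply: contrapT => noA.
    apply: noN; exists N => k Nk; rewrite ltNge; apply/negP => Ak.
    by apply: noA; exists k.
  have [m nm] : exists m, ~ escape m w.
    by apply: contrapT => nom; apply: nesc => m _; apply: contrapT => nm; apply: nom; exists m.
  apply: (@fast_cauchy_cvg _ _ (xi^~ w) (K m) N (KP m).1 NP) => n.
  apply: contrapT => noK; apply: nm; exists n => // k /= nk Kk.
  by apply: noK; exists k.
pose xi0 n (w : pOmega) : borel E := if w \in W0 then xi n w else point.
have mxi0 n : measurable_fun setT (xi0 n).
  have mW0b : measurable_fun [set: pOmega] (fun w : pOmega => w \in W0).
    apply: (measurable_fun_bool true).
    have -> : (fun w : pOmega => w \in W0) @^-1` [set true] = W0.
      by apply/seteqP; split => w /= Ww; [exact: set_mem|exact: mem_set].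
    by rewrite setTI.
  exact: measurable_fun_ifT.
have /choice[a aP] : forall w, exists l : E, (xi0 n w : E) @[n --> \oo] --> l.
  move=> w; have [Ww|nWw] := pselect (W0 w).
    have [l ll] := cvg_xi w Ww; exists l.
    by rewrite /xi0; under eq_fun do rewrite mem_set//.
  exists point; rewrite /xi0; under eq_fun do rewrite memNset//.
  exact: cvg_cst.
exists a, t, W0; split => //.
- exact: (measurable_fun_metric_cvg mxi0 aP).
- exact: toO.
- by rewrite setCK.
- move=> w Ww; have := aP w; rewrite /xi0.
  by under eq_fun do rewrite mem_set//.
Qed.

End attractor.

(** * Attraction and invariance *)

Lemma cvg_in_probability_outer (R : realType) d (Omega : measurableType d)
    (P : probability Omega R) (E : metricType R) (Y : R -> Omega -> E) (Z : Omega -> E) :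
  (forall eta t, 0 < eta -> 0 <= t -> measurable [set w | eta <= mdist (Y t w) (Z w)]) ->
  (forall eta e : R, 0 < eta -> 0 < e -> exists2 T : R, 0 <= T & forall t, T <= t ->
     outer_le P [set w | eta <= mdist (Y t w) (Z w)] e) ->
  cvg_in_probability P Y Z.
Proof.
move=> mYZ out eta eta0.
have mnear : \forall t \near +oo, measurable [set w | eta <= mdist (Y t w) (Z w)].
  by near=> t; apply: mYZ => //; near: t; exact: nbhs_pinfty_ge.
apply/fine_cvgP; split.
  by apply: filterS mnear => t mt; exact: fin_num_measure.
apply/cvgrPdist_le => e e0; have [T T0 TP] := out eta e eta0 e0.
near=> t.
have mt : measurable [set w | eta <= mdist (Y t w) (Z w)] by near: t.
have Tt : T <= t by near: t; apply: nbhs_pinfty_ge; exact: num_real.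
have := outer_le_measurable mt (TP t Tt).
rewrite -(fineK (fin_num_measure P _ mt)) lee_fin /= => le_e.
by rewrite sub0r normrN ger0_norm// fine_ge0.
Unshelve. all: by end_near. Qed.

Section attractor_properties.
Context (R : realType) (d : measure_display) (Omega : measurableType d)
  (P : probability Omega R) (E : pmetricType R)
  (theta : R -> Omega -> Omega) (phi : R -> Omega -> E -> E).
Hypotheses (htheta : metric_dynamical_system P theta)
  (hphi : random_dynamical_system theta phi).

Local Notation psi := (pullback theta phi).

Lemma pullback_flow s t x w : 0 <= s -> 0 <= t ->
  phi t w (psi s x w) = psi (t + s) x (theta t w).
Proof.
move=> s0 t0; rewrite /pullback -(mds_add htheta).
rewrite (_ : - (t + s) + t = - s); last by lra.
rewrite (rds_cocycle hphi)// -(mds_add htheta).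
by rewrite subrr (mds_zero htheta).
Qed.

Variables (c : nat -> E) (a : Omega -> borel E) (z : E) (t : nat -> R) (W0 : set Omega).
Hypotheses (dc : dense (range c)) (ma : measurable_fun setT a)
  (tn : forall n, n%:R <= t n) (mW0 : measurable W0) (PW0 : P (~` W0) = 0%E)
  (ta : forall w, W0 w -> (psi (t n) z w) @[n --> \oo] --> (a w : E)).

Let t0 n : 0 <= t n.
Proof. by apply: le_trans (tn n). Qed.

Lemma pullback_cvg_limit :
  (forall x (eta e : R), 0 < eta -> 0 < e ->
     exists2 T : R, 0 <= T & forall u u', T <= u -> T <= u' ->
       outer_le P [set w | eta <= mdist (psi u x w) (psi u' z w)] e) ->
  forall x (eta e : R), 0 < eta -> 0 < e -> exists2 T : R, 0 <= T & forall s, T <= s ->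
    outer_le P [set w | eta <= mdist (psi s x w) (a w : E)] e.
Proof.
move=> cauchy_psi x eta e eta0 e0.
have eta20 : 0 < eta / 2 by rewrite divr_gt0.
have e20 : 0 < e / 2 by rewrite divr_gt0.
have [T T0 TP] := cauchy_psi x _ _ eta20 e20.
have := as_cvg_in_prob dc (fun n => measurable_pullback htheta hphi z (t0 n))
  ma mW0 PW0 ta eta20 e20.
have large : \forall n \near \oo, T <= t n.
  near=> n; apply: le_trans (tn n); near: n; exact: nbhs_infty_ger.
move=> /(filterI large)[n _ /(_ n (leqnn n))[/= Tn close_n]].
exists T => // s Ts; rewrite (splitr e).
apply: outer_le_sub (outer_leU (TP s (t n) Ts Tn) close_n) => w /= le_eta.
have [|h1] := leP (eta / 2) (mdist (psi s x w) (psi (t n) z w)); first by left.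
right; have := metric_triangle (psi s x w) (psi (t n) z w) (a w : E).
by rewrite /=; lra.
Unshelve. all: by end_near. Qed.

(** Along the times t n, the left side phi_r(w, psi_{t n}(w)) converges to
phi_r(w, a(w)) by continuity, and by [pullback_flow] it converges in probability
to a(theta_r w). *)
Lemma limit_invariant :
  (forall (eta e : R), 0 < eta -> 0 < e -> exists2 T : R, 0 <= T & forall s, T <= s ->
    outer_le P [set w | eta <= mdist (psi s z w) (a w : E)] e) ->
  rds_invariant P theta phi (a : Omega -> E).
Proof.
move=> psi_a r r0.
have mflow_a : measurable_fun setT (fun w => phi r w (a w) : borel E).
  exact: (measurable_phi hphi).
have ma_theta : measurable_fun setT (fun w => a (theta r w)).
  exact: (measurableT_comp ma (measurable_theta htheta r)).
have mflow_psi n : measurable_fun setT (fun w => phi r w (psi (t n) z w) : borel E).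
  by apply: (measurable_phi hphi) => //; exact: (measurable_pullback htheta hphi).
pose D w := mdist (phi r w (a w)) (a (theta r w) : E).
have mD : measurable_fun setT D by exact: (mdist_measurable dc).
have D_out (eta e : R) : 0 < eta -> 0 < e -> outer_le P [set w | eta <= D w] e.
  move=> eta0 e0.
  have eta20 : 0 < eta / 2 by rewrite divr_gt0.
  have e20 : 0 < e / 2 by rewrite divr_gt0.
  have [T T0 TP] := psi_a _ _ eta20 e20.
  have flow_cvg w : W0 w -> (phi r w (psi (t n) z w)) @[n --> \oo] --> phi r w (a w).
    move=> /ta ta_w; have := rds_continuous hphi (w := w) r0.
    by move=> /(_ (a w)); exact: cvg_comp.
  have := as_cvg_in_prob dc mflow_psi mflow_a mW0 PW0 flow_cvg eta20 e20.
  have large : \forall n \near \oo, T <= t n.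
    near=> n; apply: le_trans (tn n); near: n; exact: nbhs_infty_ger.
  move=> /(filterI large)[n _ /(_ n (leqnn n))[/= Tn close_n]].
  have Trn : T <= r + t n by apply: le_trans Tn _; rewrite lerDr.
  rewrite (splitr e).
  apply: outer_le_sub (outer_leU close_n (outer_le_theta htheta r (TP _ Trn))).
  move=> w; rewrite /D /= => le_eta.
  have [|h1] := leP (eta / 2) (mdist (phi r w (psi (t n) z w)) (phi r w (a w))).
    by left.
  right; rewrite -pullback_flow//.
  have := metric_triangle (phi r w (a w)) (phi r w (psi (t n) z w)) (a (theta r w)).
  by rewrite (metric_sym (phi r w (a w)) (phi r w (psi (t n) z w))); lra.
have D_null eta : 0 < eta -> P [set w | eta <= D w] = 0%E.
  move=> eta0; apply/eqP; rewrite -measure_le0; apply/lee_addgt0Pr => e e0.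
  rewrite add0e; apply: outer_le_measurable; last exact: D_out.
  exact: measurable_set_ge.
have PD : P [set w | 0 < D w] = 0%E.
  apply/eqP; rewrite -measure_le0.
  apply: (@le_trans _ _ (\sum_(n <oo) P [set w | (n.+1%:R^-1 <= D w)%R])%E).
    apply: measure_sigma_subadditive.
    - by move=> n; exact: measurable_set_ge.
    - exact: measurable_set_gt.
    - move=> w /= Dw.
      have [n _ /(_ n (leqnn n))/= nD] := near_infty_natSinv_lt (PosNum Dw).
      by exists n => //=; exact: ltW.
  by rewrite eseries0// => n _ _; apply: D_null; rewrite invr_gt0.
exists [set w | 0 < D w]; split => //; first exact: measurable_set_gt.
move=> w /= neq; rewrite /D mdist_gt0; apply/eqP => eq_w; exact: neq.
Unshelve. all: by end_near. Qed.

End attractor_properties.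

Theorem theorem2p6 (R : realType) (d : measure_display)
    (Omega : measurableType d) (P : probability Omega R)
    (disp : Order.disp_t) (E : porderPMetricType disp R)
    (theta : R -> Omega -> Omega) (phi : R -> Omega -> E -> E)
    (mu : probability (borel E) R)
    (hE : polish R E) (hle : closed_order E)
    (htheta : metric_dynamical_system P theta)
    (hphi : random_dynamical_system theta phi)
    (hmono : order_preserving phi)
    (hmix : strongly_mixing P phi mu)
    (hmu : forall eps : R, 0 < eps ->
       exists f g : E, (f <= g)%O /\ ((1 - eps)%:E <= mu `[f, g]%classic)%E) :
  exists a : {RV P >-> borel E},
    [/\ measurable_fun [set: past theta phi] (a : past theta phi -> borel E),
        rds_invariant P theta phi (a : Omega -> E) &
        forall x : E,
          cvg_in_probability P (fun t w => phi t (theta (- t) w) x)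
            (a : Omega -> E)].
Proof.
have [c dc] := polish_dense_seq hE.
have [a [t [W0 [ma_past tn mW0 PW0 ta]]]] :=
  pullback_limit hE hle htheta hphi hmono hmix hmu point.
have ma : measurable_fun setT (a : Omega -> borel E).
  move=> _ B mB; rewrite setTI; apply: (past_sub_measurable htheta hphi).
  by rewrite -[X in measurable X]setTI; exact: ma_past.
have cauchy_psi x (eta e : R) := @pullback_cauchy _ _ _ _ _ _ _ _ _ hE hle htheta hphi
  hmono hmix hmu x point eta e.
have psi_a := pullback_cvg_limit htheta hphi dc ma tn mW0 PW0 ta cauchy_psi.
exists (mfun_Sub (mem_set ma)); split => //.
  exact: (limit_invariant htheta hphi dc ma tn mW0 PW0 ta (psi_a point)).
move=> x; apply: cvg_in_probability_outer => [eta s eta0 s0|eta e eta0 e0].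
  apply: measurable_set_ge; apply: (mdist_measurable dc _ ma).
  exact: (measurable_pullback htheta hphi).
exact: psi_a.
Qed.
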